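(* Let $d \ge 4$, $S \in \mathcal{S}^d(1)$ with $0 \in \operatorname{int}(S)$, and $l \in \{1,\ldots,d\}$. Then \[ \max_{F \in \mathcal{F}_l(S^* )} \operatorname{vol}_{\mathbb{Z}}(F) \le \frac{2(s_d-1)^2}{l!\,(s_{d-l+1}-1)}. \] Moreover: (a) if $S$ is unimodularly equivalent to $(S^d_1 - e)^*$, where $e=(1,\ldots,1)$ (equivalently, to $\operatorname{conv}\big((T^{d-1}_{1,d}\times\{0\}) \cup \{\pm e_d\}\big)$ translated so that its unique interior integral point is $0$), then equality holds for every $l$; (b) if $l \in \{1, d\}$, equality holds if and only if $S$ is unimodularly equivalent to $(S^d_1 - e)^*$.
   Context: The Sylvester sequence: $s_1 = 2$, $s_i = \prod_{j=1}^{i-1} s_j + 1$ for $i\ge2$. $\mathcal{S}^d(1)$: $d$-dimensional simplices in $\mathbb{R}^d$ with integral vertices and exactly one interior integral point. $S^*$ denotes the polar $\{y:\langle x,y\rangle\le1\ \forall x\in S\}$. $\mathcal{F}_l$: set of $l$-dimensional faces. $\operatorname{vol}_{\mathbb{Z}}(F) := \operatorname{vol}_i(F)/\det(\mathbb{Z}^d\cap\operatorname{lin}\{x-y:x,y\in F\})$ for an $i$-dimensional rational polytope $F$. $S^d_1 := \operatorname{conv}(\{0, s_1 e_1, \ldots, s_{d-1}e_{d-1}, 2(s_d-1)e_d\})$, whose unique interior integral point is $e=(1,\ldots,1)$. $T^{d-1}_{1,d} := \operatorname{conv}(\{0, s_1e_1,\ldots,s_{d-1}e_{d-1}\}) \subseteq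 \mathbb{R}^{d-1}$. Unimodular equivalence: existence of an affine bijection of $\mathbb{R}^d$ preserving $\mathbb{Z}^d$ mapping one onto the other. *)

(* Defs.v *)
(* Points of R^d are row vectors 'rV[R]_d over an arbitrary
   real closed field R (the statement is algebraic/order-theoretic). *)
From HB Require Import structures.
From mathcomp Require Import all_boot all_order all_algebra.
Set Implicit Arguments. Unset Strict Implicit. Unset Printing Implicit Defensive.
Import Order.TTheory GRing.Theory Num.Theory.
Local Open Scope ring_scope.

(* ---------- Sylvester sequence, indexed from 1:  s_1 = 2, s_i = prod_{j<i} s_j + 1 *)
(* sylv_prod n = s_1 * ... * s_n *)
Fixpoint sylv_prod (n : nat) : nat :=
  match n with
  | 0 => 1
  | n'.+1 => (sylv_prod n' * (sylv_prod n' + 1))%N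
  end.
(* sylv i = s_i for i >= 1 (sylv 0 is a meaningless dummy value) *)
Definition sylv (i : nat) : nat := (sylv_prod i.-1 + 1)%N.

Section Geometry.
Variables (R : rcfType) (d : nat).
Local Notation pt := 'rV[R]_d.

Definition dot (x y : pt) : R := \sum_(i < d) x 0 i * y 0 i.

Definition integral (x : pt) : Prop :=
  exists z : 'rV[int]_d, x = map_mx (fun a : int => a%:~R) z.

Definition conv (A : pt -> Prop) (x : pt) : Prop :=
  exists n (lam : 'I_n -> R) (p : 'I_n -> pt),
    (forall i, A (p i)) /\ (forall i, 0 <= lam i) /\
    \sum_(i < n) lam i = 1 /\ x = \sum_(i < n) lam i *: p i.

Definition lin (A : pt -> Prop) (x : pt) : Prop :=
  exists n (c : 'I_n -> R) (p : 'I_n -> pt),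
    (forall i, A (p i)) /\ x = \sum_(i < n) c i *: p i.

Definition diffs (F : pt -> Prop) (y : pt) : Prop :=
  exists a b, F a /\ F b /\ y = a - b.

Definition interior (A : pt -> Prop) (x : pt) : Prop :=
  exists eps : R, 0 < eps /\
    forall y : pt, \sum_(i < d) (y 0 i - x 0 i) ^+ 2 < eps ^+ 2 -> A y.

Definition polar (A : pt -> Prop) (y : pt) : Prop :=
  forall x, A x -> dot x y <= 1.

Definition translate (A : pt -> Prop) (t : pt) (y : pt) : Prop := A (y + t).

Definition lattice_simplex (S : pt -> Prop) : Prop :=
  exists v : 'I_d.+1 -> pt,
    (forall i, integral (v i)) /\
    row_free (\matrix_(i < d) (v (lift ord0 i) - v ord0)) /\
    (forall x, S x <-> conv (fun y => exists i, y = v i) x).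

Definition in_Sd1 (S : pt -> Prop) : Prop :=
  lattice_simplex S /\
  exists x, (integral x /\ interior S x) /\
            forall y, integral y -> interior S y -> y = x.

(* faces of P (intersections with supporting hyperplanes; a = 0 allowed,
   which yields P itself and the empty face) *)
Definition is_face (P F : pt -> Prop) : Prop :=
  exists (a : pt) (b : R), (forall x, P x -> dot a x <= b) /\
    (forall x, F x <-> (P x /\ dot a x = b)).

Definition has_dim (F : pt -> Prop) (l : nat) : Prop :=
  exists D : 'M[R]_(l, d), row_free D /\
    (forall i, lin (diffs F) (row i D)) /\
    (forall y, diffs F y -> (y <= D)%MS).

Definition lattice_basis (F : pt -> Prop) k (B : 'M[R]_(k, d)) : Prop :=
  row_free B /\
  (forall i, integral (row i B)) /\
  (forall i, lin (diffs F) (row i B)) /\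
  (forall z, integral z -> lin (diffs F) z ->
     exists c : 'rV[int]_k, z = map_mx (fun a : int => a%:~R) c *m B).

(* v = vol_Z(F) for an l-dimensional simplex F = conv{w_0,...,w_l}:
   vol_l(F) = sqrt(det Gram(w_i - w_0)) / l!,  det(Lattice) = sqrt(det Gram(B)) *)
Definition volZ (l : nat) (F : pt -> Prop) (v : R) : Prop :=
  exists (w : 'I_l.+1 -> pt) k (B : 'M[R]_(k, d)),
    (forall x, F x <-> conv (fun y => exists i, y = w i) x) /\
    lattice_basis F B /\
    let W := \matrix_(i < l) (w (lift ord0 i) - w ord0) in
    v = Num.sqrt (\det (W *m W^T)) / ((l`!)%:R * Num.sqrt (\det (B *m B^T))).

Definition max_volZ (P : pt -> Prop) (l : nat) (m : R) : Prop :=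
  exists F, is_face P F /\ has_dim F l /\ volZ l F m /\
    forall G w, is_face P G -> has_dim G l -> volZ l G w -> w <= m.

Definition unimod_equiv (A B : pt -> Prop) : Prop :=
  exists (M : 'M[R]_d) (t : pt), M \in unitmx /\
    (forall x, integral x <-> integral (x *m M + t)) /\
    (forall y, B y <-> exists x, A x /\ y = x *m M + t).

Definition e_all : pt := const_mx 1.

(* S^d_1 = conv{0, s_1 e_1, ..., s_{d-1} e_{d-1}, 2(s_d - 1) e_d};
   coordinate i : 'I_d (0-based) corresponds to e_{i+1} *)
Definition S1_coef (i : 'I_d) : R :=
  if (i.+1 < d)%N then (sylv i.+1)%:R else (2 * (sylv d - 1))%:R.

Definition S1 : pt -> Prop :=
  conv (fun y => y = 0 \/ exists i : 'I_d, y = S1_coef i *: delta_mx 0 i).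

End Geometry.

(* Main.v *)
Require Import Defs.
From Stdlib Require Import Classical.
From HB Require Import structures.
From mathcomp Require Import all_boot all_order all_algebra all_fingroup.
From mathcomp Require Import zify ring lra.
Set Implicit Arguments. Unset Strict Implicit. Unset Printing Implicit Defensive.
Import Order.TTheory GRing.Theory Num.Theory.
Local Open Scope ring_scope.

(** Let x_0 >= ... >= x_d > 0 be the barycentric coordinates of the origin in S.
    If the origin is the only interior lattice point, a pigeonhole argument
    gives x_0 ... x_(k-1) <= x_k + ... + x_d for all k.  An l-dimensional face of
    the polar simplex is spanned by l+1 of its vertices; expressing its edges in
    a basis of its lattice shows that l! vol_Z of it is the product of the
    inverses of l of its l+1 coordinates, divided by a positive integer.  Hence
    l! vol_Z <= 1 / (x_(d-l) ... x_(d-1)), and the theorem reduces to minimising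
    this product subject to the above inequalities.

    Comparing partial sums by Abel summation and AM-GM shows that the tail
    x_k + ... + x_d is at least 1 / (s_(k+1) - 1), and that the minimum is
    attained only at (1/s_1, ..., 1/s_(d-1), 1/(2(s_d-1)), 1/(2(s_d-1))).  The
    weights determine S up to the index of the lattice generated by its first d
    vertices; this index is 1 when l = d because the integer above is 1, and when
    l = 1 because any further lattice point in the span of the first d-1 vertices
    would double the left side of a product-sum inequality that is tight. *)

(** * Sequences satisfying the product-sum inequalities *)

(** The comparison cannot be run on all weights at once: the product omits [x_d], and the minimiser
    ends with two equal entries that break the Sylvester pattern. The weights are therefore cut at
    the least [j] after which every tail sum exceeds the weight preceding it. Left of [j] the tail
    is lumped into one entry, which keeps the sequence decreasing and allows a sharp comparison with
    [1/s_1, ..., 1/s_j, 1/(s_(j+1) - 1)]. Right of [j] each tail is less than twice the next, so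
    crude bounds lose only a factor depending on [d - j]. Sylvester growth absorbs this factor when
    [d - j > 1], except for a few small pairs; [d >= 4] excludes all of them but [j = 0, d = 4],
    which gets its own estimate. Equality is thus possible only for [j = d - 1]. The integer
    dividing the volume is [|det (B V^T)|], the pairing of a lattice basis [B] of the face with [l]
    vertices of [S]. *)

Section SylvesterWeights.
Variable R : realFieldType.
Implicit Types x y z w : nat -> R.

(** AM-GM against a mean at most 1; a product equal to 1 forces the mean to be 1 and puts AM-GM in
    its equality case. *)
Lemma prod_le1_of_sum_le n (E : 'I_n -> R) :
  (forall i, 0 <= E i) -> \sum_i E i <= n%:R ->
  \prod_i E i <= 1 /\ (\prod_i E i = 1 -> forall i, E i = 1).
Proof.
case: n E => [|n] E E0 sE; first by rewrite big_ord0; split=> // _ [].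
pose mu := (\sum_i E i) / n.+1%:R.
have H : \prod_i E i <= mu ^+ n.+1
    ?= iff [forall i in predT, forall j in predT, E i == E j].
  have := @leif_AGM R _ (predT : {pred 'I_n.+1}) E (fun i _ => E0 i).
  by rewrite /= card_ord.
set P := \prod_i E i in H *.
have mu0 : 0 <= mu by apply: divr_ge0 => //; apply: sumr_ge0.
have mu1 : mu <= 1 by rewrite ler_pdivrMr ?ltr0n // mul1r.
have Pmu : P <= mu ^+ n.+1 by apply: leif_le H.
have mun : mu ^+ n.+1 <= 1 by apply: exprn_ile1.
split=> [|P1]; first exact: le_trans Pmu mun.
have mun1 : mu ^+ n.+1 = 1.
  by apply: le_anti; rewrite mun -P1.
have mu1' : mu = 1 by apply/eqP; rewrite -(@pexpr_eq1 _ mu n.+1) //; apply/eqP.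
have /esym := H.2; rewrite mun1 P1 eqxx => /forallP Eeq i.
have Ei j : E j = E i.
  by have /implyP/(_ isT)/forallP/(_ i)/implyP/(_ isT)/eqP := Eeq j.
move: mu1'; rewrite /mu (eq_bigr (fun=> E i)); last by move=> j _; apply: Ei.
by rewrite sumr_const card_ord -[E i *+ _]mulr_natr mulfK // pnatr_eq0.
Qed.

(* Abel summation bounds the sum of the ratios, and AM-GM then bounds their
   product; no logarithm is needed. *)
Lemma prod_le_of_partial_sums (a n : nat) z w :
  (a < n)%N ->
  (forall i, (a <= i < n)%N -> 0 < z i) ->
  (forall i, (a <= i < n)%N -> 0 <= w i) ->
  (forall i, (a <= i)%N -> (i.+1 < n)%N -> z i.+1 <= z i) ->
  (forall k, (a <= k < n)%N -> \sum_(0 <= i < k) z i <= \sum_(0 <= i < k) w i) ->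
  \sum_(0 <= i < n) w i <= \sum_(0 <= i < n) z i ->
  \prod_(a <= i < n) w i <= \prod_(a <= i < n) z i /\
  (\prod_(a <= i < n) w i = \prod_(a <= i < n) z i ->
     forall i, (a <= i < n)%N -> w i = z i).
Proof.
move=> an z0 w0 zdec D Dn.
pose Df k := \sum_(0 <= i < k) w i - \sum_(0 <= i < k) z i.
have DfS k : Df k.+1 = Df k + (w k - z k).
  by rewrite /Df !big_nat_recr //=; ring.
(* Summation by parts: the quotient of a nonnegative surplus [Df] only grows when its denominator
   drops from [z m] to [z m.+1]. At the last index the right side has the sign of [Df n], which is
   at most 0. *)
have abel j : (a + j < n)%N ->
    \sum_(a <= i < (a + j).+1) (w i - z i) / z i <= Df (a + j).+1%N / z (a + j)%N.
  elim: j => [|j IH] jn.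
    rewrite addn0 big_nat1 DfS ler_pM2r ?invr_gt0 ?z0 ?leqnn //.
    by rewrite lerDr subr_ge0 D ?leqnn.
  rewrite addnS in jn *; set m := (a + j)%N in IH jn *.
  rewrite big_nat_recr /=; last by rewrite /m; lia.
  have zm : 0 < z m by apply: z0; rewrite /m; lia.
  have zm1 : 0 < z m.+1 by apply: z0; rewrite /m in jn *; lia.
  have Dm : 0 <= Df m.+1 by rewrite subr_ge0 D // /m; rewrite /m in jn; lia.
  have zle : z m.+1 <= z m by apply: zdec; rewrite /m in jn *; lia.
  rewrite (DfS m.+1) [X in _ <= X]mulrDl lerD2r.
  apply: le_trans (IH _) _; first lia.
  by rewrite ler_wpM2l // lef_pV2.
have zpos : 0 < \prod_(a <= i < n) z i.
  by rewrite big_nat; apply: prodr_gt0.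
have ratio : \sum_(a <= i < n) w i / z i <= (n - a)%:R.
  have -> : \sum_(a <= i < n) w i / z i =
      \sum_(a <= i < n) (w i - z i) / z i + (n - a)%:R.
    have -> : (n - a)%:R = \sum_(a <= i < n) (1 : R).
      by rewrite sumr_const_nat.
    rewrite -big_split /=; apply: eq_big_nat => i /z0 zi.
    by field; rewrite gt_eqF.
  rewrite gerDr.
  have := abel (n - a).-1; have -> : (a + (n - a).-1)%N = n.-1 by lia.
  rewrite (ltn_predK an) => H.
  apply: le_trans (H _) _; first lia.
  rewrite pmulr_lle0 ?subr_le0 // invr_gt0; apply: z0; lia.
pose E (i : 'I_(n - a)) := w (i + a)%N / z (i + a)%N.
have E0 i : 0 <= E i.
  have ? := ltn_ord i.
  by apply: divr_ge0; [apply: w0|apply/ltW/z0]; lia.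
have SE : \sum_i E i <= (n - a)%:R.
  by move: ratio; rewrite -{1}[a]add0n big_addn big_mkord.
have PE : \prod_i E i = \prod_(a <= i < n) w i / \prod_(a <= i < n) z i.
  by rewrite -prodf_div -[X in \prod_(X <= _ < _) _]add0n big_addn big_mkord.
have [P1 P2] := prod_le1_of_sum_le E0 SE.
rewrite PE in P1 P2.
split; first by move: P1; rewrite ler_pdivrMr // mul1r.
move=> eqP i ain.
have lt : (i - a < n - a)%N by lia.
have := P2 _ (Ordinal lt).
rewrite eqP divff ?gt_eqF // => /(_ erefl); rewrite /E /= subnK; last lia.
move=> H; have zi := z0 _ ain.
by rewrite -[w i](@divfK _ (z i)) ?gt_eqF // H mul1r.
Qed.

(** * Arithmetic of the Sylvester numbers *)

Local Notation u := sylv_prod.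

Lemma sylv_prod_gt0 i : (0 < u i)%N.
Proof. by elim: i => //= i IH; nia. Qed.

Lemma sylv_prodS i : u i.+1 = (u i * (u i + 1))%N.
Proof. by []. Qed.

(** Indices start at 0: [u i] is [s_(i+1) - 1], so this is [1/s_(i+1)]. *)
Definition sylv_inv (i : nat) : R := (u i + 1)%:R^-1.

Lemma sylv_prodR_gt0 i : 0 < (u i)%:R :> R.
Proof. by rewrite ltr0n sylv_prod_gt0. Qed.
#[local] Hint Resolve sylv_prodR_gt0 : core.

Lemma sylv_inv_gt0 i : 0 < sylv_inv i.
Proof. by rewrite invr_gt0 ltr0n addn1. Qed.

(** Telescoping by [1/t - 1/(t + 1) = 1/(t (t + 1))] at [t = u k]. Together with the product formula
    from index 0, it shows that the Sylvester reciprocals turn every product-sum inequality into an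
    equality. *)
Lemma sum_sylv_inv k : \sum_(0 <= i < k) sylv_inv i = 1 - (u k)%:R^-1.
Proof.
elim: k => [|k IH]; first by rewrite big_nil invr1 subrr.
rewrite big_nat_recr //= IH /sylv_inv natrM natrD.
have := sylv_prodR_gt0 k; move: (u k)%:R => t t0.
by field; rewrite !gt_eqF //= ltr_wpDl // ltW.
Qed.

Lemma prod_sylv_inv a k : (a <= k)%N ->
  \prod_(a <= i < k) sylv_inv i = (u a)%:R / (u k)%:R.
Proof.
move=> ak; rewrite -(subnKC ak); elim: (k - a)%N => [|m IH].
  by rewrite addn0 big_geq // divff // gt_eqF.
rewrite addnS big_nat_recr ?leq_addr //= IH /sylv_inv natrM natrD.
have := sylv_prodR_gt0 (a + m); move: (u (a + m))%:R => t t0.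
by field; rewrite !gt_eqF //= ltr_wpDl // ltW.
Qed.


(** The loss in [tail_prod_ge]: the largest of [m' + 2] tail terms is at least [1/(m' + 2)] of the
    tail, and passing to the next tail costs a factor 2 in each of [m'] powers. *)
Fixpoint tail_const (m : nat) : nat :=
  if m is m'.+1 then ((m' + 2) * 2 ^ m' * tail_const m')%N else 1%N.

Lemma sylv_prod_ge3 j m : (0 < j)%N -> (3 ^ m * u j <= u (j + m))%N.
Proof.
move=> j0; have uj i : (0 < i)%N -> (2 <= u i)%N.
  by case: i => // i _; rewrite sylv_prodS; have := sylv_prod_gt0 i; nia.
elim: m => [|m IH]; first by rewrite addn0 mul1n.
rewrite addnS sylv_prodS expnS; have := uj (j + m)%N; nia.
Qed.

Lemma sylv_prod_ge6 j : (1 < j)%N -> (6 <= u j)%N.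
Proof.
case: j => [|[|j]] // _.
have := sylv_prod_ge3 j.+1 (isT : 0 < 1)%N; rewrite add1n; apply: leq_trans.
by rewrite expnS -mulnA mulnC -mulnA leq_pmull ?expn_gt0.
Qed.

(** Doubly exponential growth beats [tail_const]. The excluded pair [(0, 4)] is a genuine exception,
    as it would require [7680 < 3528]; the condition [4 <= j + m] excludes [(1, 2)], which would
    require [96 < 72]. *)
Lemma tail_const_lt j m : (1 < m)%N -> (4 <= j + m)%N -> (j, m) != (0, 4)%N ->
  (tail_const m * u j ^ m.+1 < 2 * u (j + m.-1) ^ 2)%N.
Proof.
(* Passing from m to m+1 multiplies the right side by (u (j + m.-1) + 1)^2,
   hence it suffices to compare this factor with the one on the left. *)
have step m0 : (1 < m0)%N -> ((m0 + 2) * 2 ^ m0 * u j <= u (j + m0.-1) ^ 2)%N ->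
    (tail_const m0 * u j ^ m0.+1 < 2 * u (j + m0.-1) ^ 2)%N ->
    (tail_const m0.+1 * u j ^ m0.+2 < 2 * u (j + m0) ^ 2)%N.
  move=> m1 H1 H2; have -> : (j + m0 = (j + m0.-1).+1)%N by lia.
  rewrite sylv_prodS /= (expnS _ m0.+1).
  have -> : ((m0 + 2) * 2 ^ m0 * tail_const m0 * (u j * u j ^ m0.+1) =
    ((m0 + 2) * 2 ^ m0 * u j) * (tail_const m0 * u j ^ m0.+1))%N by ring.
  have -> : (2 * (u (j + m0.-1) * (u (j + m0.-1) + 1)) ^ 2 =
    (u (j + m0.-1) + 1) ^ 2 * (2 * u (j + m0.-1) ^ 2))%N by ring.
  by apply: ltn_mul => //; apply: leq_ltn_trans H1 _; rewrite ltn_exp2r // addn1.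
(* For [j = 0] the growth by factors of 3 starts only at [u 1], which costs one exponent; hence
   [pow] there and [pow1] for [j > 0]. *)
have pow k : (5 <= k)%N -> ((k + 2) * 2 ^ k <= 9 ^ (k - 2))%N.
  elim: k => // k IH; rewrite leq_eqVlt => /predU1P[<- //|k5].
  have -> : (k.+1 - 2 = (k - 2).+1)%N by lia.
  have := IH k5; rewrite !expnS; move: (2 ^ k)%N (9 ^ _)%N => A B; nia.
have pow1 k : (3 <= k)%N -> ((k + 2) * 2 ^ k <= 9 ^ (k - 1))%N.
  elim: k => // k IH; rewrite leq_eqVlt => /predU1P[<- //|k5].
  have -> : (k.+1 - 1 = (k - 1).+1)%N by lia.
  have := IH k5; rewrite !expnS; move: (2 ^ k)%N (9 ^ _)%N => A B; nia.
have growth k : (0 < j)%N -> (3 <= k)%N ->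
    ((k + 2) * 2 ^ k * u j <= u (j + k.-1) ^ 2)%N.
  move=> j0 k3; have := sylv_prod_ge3 k.-1 j0; have := pow1 _ k3.
  rewrite subn1 => H1 H2.
  have : ((3 ^ k.-1 * u j) ^ 2 <= u (j + k.-1) ^ 2)%N by rewrite leq_exp2r.
  rewrite expnMn -expnM [(k.-1 * 2)%N]mulnC expnM; apply: leq_trans.
  apply: leq_mul => //; have := sylv_prod_gt0 j; nia.
case: j step growth => [|j] step growth.
  move=> _; rewrite add0n => m4 n4.
  have {m4 n4} m5 : (5 <= m)%N.
    have : m != 4%N by apply: contraNneq n4 => ->.
    lia.
  elim: m m5 => // m IH; rewrite leq_eqVlt => /predU1P[<-|m5].
    have -> : u (0 + 5.-1) = 1806%N by [].
    by rewrite [u 0]/= exp1n [tail_const 5]/=; lia.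
  apply: step (IH m5); first lia.
  have -> : (0 + m.-1 = 1 + (m - 2))%N by lia.
  have := sylv_prod_ge3 (m - 2) (isT : 0 < 1)%N; have := pow _ m5.
  move=> H1 H2.
  have : ((3 ^ (m - 2) * u 1) ^ 2 <= u (1 + (m - 2)) ^ 2)%N by rewrite leq_exp2r.
  rewrite expnMn -expnM [((m - 2) * 2)%N]mulnC expnM; apply: leq_trans.
  by apply: leq_mul.
move=> m1 jm _.
have base2 : (0 < j)%N -> (tail_const 2 * u j.+1 ^ 3 < 2 * u (j.+1 + 1) ^ 2)%N.
  move=> j0; rewrite addn1 (sylv_prodS j.+1).
  have u6 : (6 <= u j.+1)%N by apply: sylv_prod_ge6.
  have -> : tail_const 2 = 12%N by [].
  move: (u j.+1) u6 => t t6.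
  have -> : (2 * (t * (t + 1)) ^ 2 = 2 * (t + 1) ^ 2 * t ^ 2)%N by ring.
  rewrite expnS mulnA ltn_pmul2r ?expn_gt0 //; first nia.
  by rewrite (leq_trans _ t6).
have base3 : (tail_const 3 * u j.+1 ^ 4 < 2 * u (j.+1 + 2) ^ 2)%N.
  case: (posnP j) => [->|j0]; first by [].
  apply: step (base2 j0) => //.
  have := sylv_prod_ge3 1 (isT : 0 < j.+1)%N.
  have : (6 <= u j.+1)%N by apply: sylv_prod_ge6.
  rewrite /= ; move: (u j.+1) (u (j.+1 + 1)) => t s; nia.
case: (eqVneq m 2) => [m2|m2].
  by subst m; apply: base2; lia.
have {m1 m2 jm} : (3 <= m)%N by lia.
elim: m => // m IH; rewrite leq_eqVlt => /predU1P[<- //|m3].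
by apply: step (IH m3); [lia|apply: growth].
Qed.

Definition ext_weight (d i : nat) : R :=
  if (i < d.-1)%N then sylv_inv i else (2 * u d.-1)%:R^-1.

(** * Decreasing weights under the product-sum inequalities *)

Section ProductSum.
Variables (d : nat) (x : nat -> R).
Hypothesis x_gt0 : forall i, (i <= d)%N -> 0 < x i.
Hypothesis x_dec : forall i, (i < d)%N -> x i.+1 <= x i.
Hypothesis x_sum : \sum_(0 <= i < d.+1) x i = 1.
Hypothesis x_ps : forall k, (k <= d)%N ->
  \prod_(0 <= i < k) x i <= 1 - \sum_(0 <= i < k) x i.

Local Notation T k := (1 - \sum_(0 <= i < k) x i).

(** If the sum up to [k.+1] reaches the Sylvester sum while the earlier ones stay below, the
    comparison makes the product of the [x i] at least the Sylvester product. The product-sum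
    inequality gives the reverse, being tight for Sylvester reciprocals, so all terms agree. The
    bound and its rigidity are proved together because the bound itself follows from the equality
    case. *)
Lemma partial_sum_sylv k : (k <= d)%N ->
  \sum_(0 <= i < k) x i <= \sum_(0 <= i < k) sylv_inv i /\
  (\sum_(0 <= i < k) sylv_inv i <= \sum_(0 <= i < k) x i ->
   forall i, (i < k)%N -> x i = sylv_inv i).
Proof.
have [n] := ubnP k; elim: n k => // n IH [|k] kn kd; first by rewrite !big_nil.
suff H : \sum_(0 <= i < k.+1) sylv_inv i <= \sum_(0 <= i < k.+1) x i ->
   forall i, (i < k.+1)%N -> x i = sylv_inv i.
  split=> //; rewrite leNgt; apply/negP => lt; have E := H (ltW lt).
  move: lt; rewrite [X in _ < X](eq_big_nat _ _ (F2 := sylv_inv)) ?ltxx //.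
move=> le i ik.
have [||||||] := @prod_le_of_partial_sums 0 k.+1 x sylv_inv.
- by [].
- by move=> j jk; apply: x_gt0; lia.
- by move=> j jk; apply/ltW/sylv_inv_gt0.
- by move=> j _ jk; apply: x_dec; lia.
- by move=> j jk; have [] := IH j ltac:(lia) ltac:(lia).
- by [].
move=> P1 E; apply/esym/E => //.
apply: le_anti; apply/andP; split; first by [].
apply: le_trans (x_ps kd) _; rewrite prod_sylv_inv // div1r.
by rewrite lerBlDl -lerBlDr -sum_sylv_inv.
Qed.

Lemma tail_ge k : (k <= d)%N -> (u k)%:R^-1 <= T k.
Proof.
by move=> /partial_sum_sylv[]; rewrite sum_sylv_inv lerBrDl -lerBrDr.
Qed.

Lemma tail_eq k : (k <= d)%N -> T k = (u k)%:R^-1 ->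
  forall i, (i < k)%N -> x i = sylv_inv i.
Proof.
by move=> /partial_sum_sylv[_ H] E; apply: H; rewrite sum_sylv_inv -E; lra.
Qed.

Lemma tail_sum k : (k <= d.+1)%N -> T k = \sum_(k <= i < d.+1) x i.
Proof. by move=> kd; rewrite -x_sum (big_cat_nat _ (n := k)) //= addrC addrK. Qed.

Lemma x_anti i j : (i <= j)%N -> (j <= d)%N -> x j <= x i.
Proof.
move=> ij jd; rewrite -(subnKC ij) in jd *; elim: (j - i)%N jd => [|k IH] jd.
  by rewrite addn0.
rewrite addnS in jd *; apply: le_trans (x_dec _) (IH _) => //; exact: ltnW.
Qed.

(** The tail is lumped into the single entry [T j]; the assumption [T j <= x j.-1] keeps the
    resulting sequence decreasing. It is compared with the first [j] Sylvester reciprocals followed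
    by [1/u j]: both sequences sum to 1. In case of equality the lumped entry is read off. *)
Lemma head_prod_ge a j : (a <= j)%N -> (j <= d)%N ->
  ((a < j)%N -> T j <= x j.-1) ->
  (u a)%:R / (u j)%:R ^+ 2 <= \prod_(a <= i < j) x i * T j /\
  ((u a)%:R / (u j)%:R ^+ 2 = \prod_(a <= i < j) x i * T j ->
    T j = (u j)%:R^-1).
Proof.
rewrite leq_eqVlt => /predU1P[->|aj] jd Tx.
  rewrite big_geq // mul1r expr2 invfM mulrA divff ?mul1r ?gt_eqF //.
  by split=> [|->//]; apply: tail_ge.
have {}Tx := Tx aj.
have Tj0 : 0 < T j by apply: lt_le_trans (tail_ge jd); rewrite invr_gt0.
pose z i := if (i < j)%N then x i else T j.
pose w i := if (i < j)%N then sylv_inv i else (u j)%:R^-1.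
have sz k : (k <= j)%N -> \sum_(0 <= i < k) z i = \sum_(0 <= i < k) x i.
  move=> kj; apply: eq_big_nat => i ik; rewrite /z ifT //; lia.
have sw k : (k <= j)%N -> \sum_(0 <= i < k) w i = \sum_(0 <= i < k) sylv_inv i.
  move=> kj; apply: eq_big_nat => i ik; rewrite /w ifT //; lia.
have pz : \prod_(a <= i < j.+1) z i = \prod_(a <= i < j) x i * T j.
  rewrite big_nat_recr; last exact: ltnW.
  rewrite {2}/z ltnn /=; congr (_ * _).
  by apply: eq_big_nat => i ik; rewrite /z ifT //; lia.
have pw : \prod_(a <= i < j.+1) w i = (u a)%:R / (u j)%:R ^+ 2.
  rewrite big_nat_recr; last exact: ltnW.
  rewrite {2}/w ltnn /= expr2 invfM mulrA -prod_sylv_inv ?(ltnW aj) //.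
  congr (_ * _); by apply: eq_big_nat => i ik; rewrite /w ifT //; lia.
have [||||||] := @prod_le_of_partial_sums a j.+1 z w.
- by rewrite ltnS ltnW.
- by move=> i ij; rewrite /z; case: ifP => // ijj; apply: x_gt0; lia.
- move=> i ij; rewrite /w; case: ifP => _; first by apply/ltW/sylv_inv_gt0.
  by rewrite invr_ge0 ltW.
- move=> i ai ij; rewrite /z.
  have -> : (i < j)%N by lia.
  case: ifP => ij1; first by apply: x_dec; lia.
  by have -> : i = j.-1 by lia.
- move=> k kj; have kj' : (k <= j)%N by lia.
  by rewrite sz // sw //; have [] := @partial_sum_sylv k ltac:(lia).
- rewrite !big_nat_recr //= sz // sw // sum_sylv_inv /z /w ltnn.
  by move: (u j)%:R^-1 => t; lra.
rewrite pz pw => le E; split=> // /E/(_ j).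
by rewrite /w /z ltnn ltnSn ltnW // => /(_ isT) ->.
Qed.

(** Induction on the length of the tail: [T j] is bounded by its number of terms times the largest
    one, [x j], and [x j < T j.+1] gives [T j < 2 * T j.+1]. *)
Lemma tail_prod_ge m j : d = (j + m)%N ->
  (forall i, (j < i < d)%N -> x i.-1 < T i) ->
  T j ^+ m <= (tail_const m)%:R * \prod_(j <= i < d) x i.
Proof.
elim: m j => [|m IH] j dE Tx.
  by rewrite expr0 mul1r dE addn0 big_geq.
have jd : (j < d)%N by lia.
have Tj0 k : (k <= d)%N -> 0 < T k.
  by move=> kd; apply: lt_le_trans (tail_ge kd); rewrite invr_gt0.
have IHj : T j.+1 ^+ m <= (tail_const m)%:R * \prod_(j.+1 <= i < d) x i.
  by apply: IH => [|i ij]; [lia|apply: Tx; lia].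
have Tjx : T j <= (m + 2)%:R * x j.
  rewrite tail_sum; last lia.
  have -> : (m + 2)%:R * x j = \sum_(j <= i < d.+1) x j.
    rewrite sumr_const_nat mulr_natl; congr (_ *+ _); lia.
  apply: ler_sum_nat => i ij; apply: x_anti; lia.
have Thalf : T j ^+ m <= 2 ^+ m * T j.+1 ^+ m.
  (* When [j.+1 = d] the hypothesis gives no comparison of [x j] with [T j.+1], but the exponent is
     then 0. *)
  case: m dE {IH IHj Tjx} => [|m] dE; first by rewrite !expr0 mul1r.
  rewrite -exprMn; apply: lerXn2r; rewrite ?nnegrE.
  - by apply/ltW/Tj0; lia.
  - by rewrite mulr_ge0 // ltW ?Tj0.
  have := Tx j.+1; rewrite big_nat_recr //= => H.
  have {H} := H ltac:(lia); lra.
rewrite exprS [tail_const _]/= [\prod_(j <= _ < _) _]big_ltn // !natrM natrX.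
have -> : (m + 2)%:R * 2 ^+ m * (tail_const m)%:R *
    (x j * \prod_(j.+1 <= i < d) x i) = ((m + 2)%:R * x j) *
   (2 ^+ m * ((tail_const m)%:R * \prod_(j.+1 <= i < d) x i)) :> R by ring.
apply: ler_pM => //.
- by apply/ltW/Tj0; lia.
- by apply/exprn_ge0/ltW/Tj0; lia.
apply: le_trans Thalf _; apply: ler_wpM2l => //; exact: exprn_ge0.
Qed.

(** The general constant treats [1 <= 5 x_0] and [1 <= 2 T 1] as tight together, which would need
    [x_0 = 1/5] and [x_0 = 1/2] at once. Keeping [t = x_0] variable, [t (1 - t)^3 >= 1/16] on
    [[1/5, 1/2]], so the product is at least [1/3072 > 1/3528], where [3072 = 16 * 192]. *)
Lemma tail_prod_gt_dim4 : d = 4 -> (forall i, (0 < i < d)%N -> x i.-1 < T i) ->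
  (2 * u 3 ^ 2)%:R^-1 < \prod_(0 <= i < d) x i.
Proof.
move=> d4 Tx.
have := @tail_prod_ge 3 1; rewrite d4 => /(_ erefl) H.
have {H} : T 1 ^+ 3 <= 192%:R * \prod_(1 <= i < 4) x i.
  by apply: H => i ij; apply: Tx; lia.
have x0 : 1 <= 5%:R * x 0%N.
  rewrite -[X in X <= _]x_sum d4; have -> : 5%:R * x 0%N = \sum_(0 <= i < 5) x 0%N.
    by rewrite sumr_const_nat mulr_natl.
  by apply: ler_sum_nat => i ij; apply: x_anti; lia.
have := Tx 1%N; rewrite d4 => /(_ isT).
have x00 : 0 < x 0%N by apply: x_gt0.
rewrite big_nat1 (big_ltn (isT : 0 < 4)%N); move: (\prod_(1 <= i < 4) _) => P.
move: (x 0%N) x0 x00 => t t5 t0 t2.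
have -> : (2 * u 3 ^ 2)%N = 3528%N by [].
move=> HP.
have : (1 - t) ^+ 3 * t <= 192%:R * P * t by rewrite ler_wpM2r // ltW.
have Q : 1 / 16%:R <= (1 - t) ^+ 3 * t.
  (* The difference with [1/16] vanishes at the endpoint [t = 1/2]; the cubic cofactor is then
     expanded at the other endpoint [1/5]. *)
  have -> : (1 - t) ^+ 3 * t =
    (2^-1 - t) * (t ^+ 3 - 5%:R / 2 * t ^+ 2 + 7%:R / 4 * t - 8^-1) + 1 / 16%:R.
    by field.
  rewrite lerDr; apply: mulr_ge0; first lra.
  have -> : t ^+ 3 - 5%:R / 2 * t ^+ 2 + 7%:R / 4 * t - 8^-1 =
    (t - 1 / 5%:R) * (t ^+ 2 - 23%:R / 10%:R * t + 129%:R / 100%:R) +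
     133%:R / 1000%:R by field.
  apply: addr_ge0; last lra.
  apply: mulr_ge0; first lra.
  have := sqr_ge0 t; lra.
move=> H; rewrite invf_plt ?posrE //; last lra.
rewrite -[_^-1]div1r ltr_pdivrMr; last lra.
lra.
Qed.

Lemma weights_prod_ge a : (4 <= d)%N -> (a < d)%N ->
  (u a)%:R / (2 * u d.-1 ^ 2)%:R <= \prod_(a <= i < d) x i /\
  ((u a)%:R / (2 * u d.-1 ^ 2)%:R = \prod_(a <= i < d) x i ->
   forall i, (i <= d)%N -> x i = ext_weight d i).
Proof.
move=> d4 ad.
(* The cut. [Q j] is the hypothesis of [tail_prod_ge], and its failure at [j.-1] is the hypothesis
   of [head_prod_ge]. *)
pose Q j := (a <= j)%N && all (fun i => (j < i)%N ==> (x i.-1 < T i)) (iota 0 d).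
have exQ : exists j, Q j.
  exists d.-1; rewrite /Q; apply/andP; split; first lia.
  by apply/allP => i; rewrite mem_iota => id; apply/implyP; lia.
case: (ex_minnP exQ) => j /andP[aj /allP Qj] jmin.
have jd : (j <= d.-1)%N.
  apply: jmin; rewrite /Q; apply/andP; split; first lia.
  by apply/allP => i; rewrite mem_iota => id; apply/implyP; lia.
have {}Qj i : (j < i < d)%N -> x i.-1 < T i.
  move=> ij; have /Qj/implyP -> // : i \in iota 0 d by rewrite mem_iota; lia.
  by case/andP: ij.
have Tj : (a < j)%N -> T j <= x j.-1.
  move=> aj'; rewrite leNgt; apply/negP => Tj.
  have := jmin j.-1; rewrite /Q => H.
  suff : (j <= j.-1)%N by lia.
  apply: H; apply/andP; split; first lia.
  apply/allP => i; rewrite mem_iota => id; apply/implyP => ij.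
  case: (eqVneq i j) => [->//|ne]; apply: Qj; lia.
have jd' : (j <= d)%N by lia.
have [hd1 hd2] := head_prod_ge aj jd' Tj.
have Tj0 k : (k <= d)%N -> 0 < T k.
  by move=> kd; apply: lt_le_trans (tail_ge kd); rewrite invr_gt0.
have ajpos : 0 < \prod_(a <= i < j) x i.
  by rewrite big_nat; apply: prodr_gt0 => i ij; apply: x_gt0; lia.
have jpos : 0 < \prod_(j <= i < d) x i.
  by rewrite big_nat; apply: prodr_gt0 => i ij; apply: x_gt0; lia.
have Pcat : \prod_(a <= i < d) x i =
    \prod_(a <= i < j) x i * \prod_(j <= i < d) x i.
  by rewrite (big_cat_nat _ (n := j)).
(* The only cut that allows equality: the remaining product is [x d.-1], at least half of the tail
   [x d.-1 + x d]. *)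
case: (eqVneq j d.-1) => [jE|jn].
  have dE : d = j.+1 by lia.
  have Tx2 : T j = x j + x d.
    rewrite tail_sum; last lia.
    by rewrite dE big_nat_recr //= big_nat1.
  have xjd : x d <= x j by apply: x_anti; lia.
  have PE : \prod_(j <= i < d) x i = x j by rewrite dE big_nat1.
  have LE : (u a)%:R / (2 * u d.-1 ^ 2)%:R = (u a)%:R / (u j)%:R ^+ 2 / 2 :> R.
    by rewrite -jE natrM natrX; field; rewrite gt_eqF.
  rewrite LE Pcat PE.
  have le2 : \prod_(a <= i < j) x i * T j / 2 <= \prod_(a <= i < j) x i * x j.
    by rewrite -mulrA ler_pM2l // Tx2; lra.
  split; first by apply: le_trans le2; rewrite ler_pM2r // invr_gt0.
  move=> E.
  have E1 : (u a)%:R / (u j)%:R ^+ 2 = \prod_(a <= i < j) x i * T j.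
    by apply: le_anti; rewrite hd1 /=; lra.
  have TE := hd2 E1.
  have xjE : x j = T j / 2.
    apply: (mulfI (lt0r_neq0 ajpos)).
    by rewrite -E E1 mulrA.
  have ueq : (2 * u d.-1)%:R^-1 = T j / 2.
    by rewrite TE -jE natrM invfM mulrC.
  move=> i id; rewrite /ext_weight -jE; case: ifP => ij.
    exact: tail_eq TE _ ij.
  rewrite jE ueq; have [->|->] : i = j \/ i = d by lia.
    by [].
  by move: Tx2; rewrite xjE; lra.
suff lt : (u a)%:R / (2 * u d.-1 ^ 2)%:R < \prod_(a <= i < d) x i.
  by split; [apply: ltW|move=> E; move: lt; rewrite E ltxx].
have upos : 0 < (2 * u d.-1 ^ 2)%:R :> R.
  by rewrite ltr0n muln_gt0 expn_gt0 sylv_prod_gt0.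
case: (eqVneq (j, d - j)%N (0, 4)%N) => [[j0]|njm].
  rewrite j0 subn0 => d4'.
  have -> : a = 0%N by lia.
  rewrite mul1r d4'; have := tail_prod_gt_dim4 d4'; rewrite d4'; apply.
  by move=> i id; apply: Qj; rewrite j0 d4'.
have dE : d = (j + (d - j))%N by lia.
have := tail_prod_ge dE Qj.
have := @tail_const_lt j (d - j) ltac:(lia) ltac:(lia) njm.
have -> : (j + (d - j).-1 = d.-1)%N by lia.
set m := (d - j)%N; rewrite -(ltr_nat R) natrM natrX => lt1 le2.
have c0 : 0 < (tail_const m)%:R :> R.
  rewrite ltr0n; elim: (m) => //= k IH.
  by rewrite !muln_gt0 IH expn_gt0 addn2.
rewrite Pcat ltr_pdivrMr //.
have Tm : (u j)%:R^-1 ^+ m.-1 <= T j ^+ m.-1.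
  apply: lerXn2r; last exact: tail_ge.
    by rewrite nnegrE invr_ge0 ltW.
  by rewrite nnegrE ltW // Tj0.
have mS : m = m.-1.+1 by rewrite /m; lia.
(* Of the [m] factors [T j], one enters the head comparison and the other [m - 1] are bounded below
   by [1/u j]; hence the exponent [m + 1]. *)
have A1 : (u a)%:R / (u j)%:R ^+ m.+1 <=
    \prod_(a <= i < j) x i * ((tail_const m)%:R * \prod_(j <= i < d) x i).
  apply: le_trans (ler_wpM2l (ltW ajpos) le2).
  have -> : (u a)%:R / (u j)%:R ^+ m.+1 =
      ((u a)%:R / (u j)%:R ^+ 2) * (u j)%:R^-1 ^+ m.-1 :> R.
    rewrite {1}mS -addn2 exprD invfM exprVn; ring.
  have -> : T j ^+ m = T j * T j ^+ m.-1 by rewrite {1}mS exprS.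
  rewrite [X in _ <= X]mulrA; apply: ler_pM => //.
    by rewrite divr_ge0 // ?exprn_ge0 // ltW.
  by rewrite exprn_ge0 // invr_ge0 ltW.
have uj0 := sylv_prodR_gt0 j.
have ujm : 0 < (u j)%:R ^+ m.+1 :> R by rewrite exprn_gt0.
rewrite ler_pdivrMr // in A1.
have XY0 : 0 < \prod_(a <= i < j) x i * \prod_(j <= i < d) x i by rewrite mulr_gt0.
apply: le_lt_trans A1 _.
move: XY0 lt1; move: (\prod_(a <= i < j) x i) (\prod_(j <= i < d) x i) => X Y.
move: (tail_const m)%:R (_ ^+ m.+1) (2 * _)%:R => c U V XY0 lt1.
have -> : X * (c * Y) * U = X * Y * (c * U) by ring.
by rewrite ltr_pM2l.
Qed.

End ProductSum.
End SylvesterWeights.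

(** * A pigeonhole principle for lattices *)

Lemma card_ord_lt n a : (a <= n)%N -> #|[pred z : 'I_n | (z < a)%N]| = a.
Proof.
move=> an; rewrite -sum1_card (eq_bigl (fun z : 'I_n => (z < a)%N)) //.
by rewrite (big_ord_narrow an) sum1_card card_ord.
Qed.

(* Pigeonhole in Z^(k+1) modulo the image of a 1^T - q I, a sublattice of index
   s q^k.  The class of y is read off explicitly: writing sum y = s n + r, it is
   given by r and by y_i + a_i n mod q for all i but the last. *)
Lemma box_collision (k q s h : nat) (a : 'I_k.+1 -> nat)
    (g : 'I_h -> 'I_k.+1 -> int) :
  (0 < s)%N -> (\sum_i a i + s = q)%N -> (s * q ^ k < h * \prod_i a i)%N ->
  exists (e e' : 'I_h) (f f' m : 'I_k.+1 -> int),
    [/\ forall i, 0 <= f i < (a i)%:Z, forall i, 0 <= f' i < (a i)%:Z,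
        e <> e' \/ exists i, f i <> f' i &
        forall i, f i - f' i + (g e i - g e' i) =
                  (a i)%:Z * (\sum_j m j) - q%:Z * m i].
Proof.
case: s => // s _ qE lt.
have aq i : (a i <= q)%N by rewrite -qE (bigD1 i) //= -!addnA leq_addr.
case: q qE aq lt => [|q]; first by rewrite addnS.
move=> qE aq lt.
pose D := setX [set: 'I_h] [set f | f \in family (fun i => [pred z : 'I_q.+1 | (z < a i)%N])].
pose Y (p : 'I_h * {ffun 'I_k.+1 -> 'I_q.+1}) i : int := (p.2 i : nat)%:Z + g p.1 i.
pose sg p := \sum_i Y p i.
pose n p := (sg p %/ s.+1%:Z)%Z.
pose r p := (sg p %% s.+1%:Z)%Z.
pose wd := widen_ord (leqnSn k).
pose t p (i : 'I_k) := Y p (wd i) + (a (wd i))%:Z * n p.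
pose phi p : 'I_s.+1 * {ffun 'I_k -> 'I_q.+1} :=
  (inord `|r p|%N, [ffun i => inord `|(t p i %% q.+1%:Z)%Z|%N]).
have cardD : #|D| = (h * \prod_i a i)%N.
  rewrite cardsX cardsT card_ord cardsE card_family foldrE big_map big_enum /=.
  by congr (_ * _)%N; apply: eq_bigr => i _; apply: card_ord_lt.
have /dinjectivePn[p pD [p' /andP[pp' p'D] phiE]] : ~~ dinjectiveb phi D.
  apply/negP => /dinjectiveP/card_in_imset cE.
  have := max_card [set phi x | x in D]; rewrite cE cardD.
  by rewrite card_prod card_ffun !card_ord leqNgt lt.
have inordE m x y : inord (n' := m) `|(x %% m.+1%:Z)%Z|%N = inord `|(y %% m.+1%:Z)%Z|%N ->
    (x %% m.+1%:Z)%Z = (y %% m.+1%:Z)%Z.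
  move=> /(congr1 val) /=; have m0 : m.+1%:Z != 0 by [].
  have bd z : (`|(z %% m.+1%:Z)%Z| < m.+1)%N.
    by rewrite -ltz_nat gez0_abs ?modz_ge0 // ltz_pmod.
  rewrite !inordK // => H; rewrite -(gez0_abs (modz_ge0 x m0)).
  by rewrite -(gez0_abs (modz_ge0 y m0)) H.
case: phiE => /inordE rE tE.
have {}tE i : (t p i %% q.+1%:Z)%Z = (t p' i %% q.+1%:Z)%Z.
  by move/ffunP/(_ i): tE; rewrite !ffunE => /inordE.
pose De := n p - n p'.
pose ka i := (t p i %/ q.+1%:Z)%Z - (t p' i %/ q.+1%:Z)%Z.
have kaE i : Y p (wd i) - Y p' (wd i) + (a (wd i))%:Z * De = q.+1%:Z * ka i.
  have -> : Y p (wd i) - Y p' (wd i) + (a (wd i))%:Z * De = t p i - t p' i.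
    by rewrite /t /De; ring.
  rewrite {1}(divz_eq (t p i) q.+1%:Z) {1}(divz_eq (t p' i) q.+1%:Z) tE /ka.
  ring.
have sE : sg p - sg p' = s.+1%:Z * De.
  rewrite {1}(divz_eq (sg p) s.+1%:Z) {1}(divz_eq (sg p') s.+1%:Z) rE /De /n.
  ring.
(* These coefficients are forced: their sum must be [- De], the first [k] coordinates then give
   [- ka i], and the last entry absorbs the rest. *)
pose m (i : 'I_k.+1) : int :=
  if unlift ord_max i is Some j then - ka j else (\sum_j ka j) - De.
have wdE j : lift ord_max j = wd j by apply/val_inj; rewrite /= /bump leqNgt ltn_ord.
have mwd j : m (wd j) = - ka j by rewrite /m -wdE liftK.
have mmax : m ord_max = (\sum_j ka j) - De by rewrite /m unlift_none.
have sm : \sum_j m j = - De.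
  rewrite big_ord_recr /= mmax (eq_bigr (fun j => - ka j)); last by move=> j _; apply: mwd.
  by rewrite sumrN; ring.
exists p.1, p'.1, (fun i => (p.2 i : nat)%:Z), (fun i => (p'.2 i : nat)%:Z), m; split.
- by move=> i; move: pD; rewrite !inE => /familyP/(_ i); rewrite inE ltz_nat.
- by move=> i; move: p'D; rewrite !inE => /familyP/(_ i); rewrite inE ltz_nat.
- case: (eqVneq p.1 p'.1) => [e1|/eqP]; last by left.
  right; case: (pickP (fun i => p.2 i != p'.2 i)) => [i /eqP ne|eq2].
    by exists i => -[/val_inj].
  case/eqP: pp'; apply: injective_projections => //; apply/ffunP => i.
  by move/negbT: (eq2 i); rewrite negbK => /eqP.
move=> i; rewrite sm.
have -> : (p.2 i : nat)%:Z - (p'.2 i : nat)%:Z + (g p.1 i - g p'.1 i) = Y p i - Y p' i.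
  by rewrite /Y; ring.
case: (unliftP ord_max i) => [j ->|->].
  rewrite wdE mwd.
  have -> : q.+1%:Z * - ka j = - (q.+1%:Z * ka j) by rewrite mulrN.
  rewrite -kaE; ring.
(* [phi] does not record the last coordinate. It is recovered from the total [sg], because the
   modulus is the sum of all [a i] and of [s]. *)
rewrite mmax.
have := sE; rewrite /sg !big_ord_recr /= => E.
have E2 : \sum_(j < k) Y p (wd j) - \sum_(j < k) Y p' (wd j) +
   (\sum_(j < k) (a (wd j))%:Z) * De = q.+1%:Z * \sum_j ka j.
  rewrite -sumrB mulr_suml -big_split mulr_sumr; apply: eq_bigr => j _; exact: kaE.
have E3 : q.+1%:Z = \sum_(j < k) (a (wd j))%:Z + (a ord_max)%:Z + s.+1%:Z.
  by rewrite -qE PoszD (big_morph Posz PoszD (erefl (Posz 0))) big_ord_recr.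
have -> : Y p ord_max - Y p' ord_max = s.+1%:Z * De -
   (\sum_(j < k) Y p (wd j) - \sum_(j < k) Y p' (wd j)) by rewrite -E; ring.
have -> : \sum_(j < k) Y p (wd j) - \sum_(j < k) Y p' (wd j) =
   q.+1%:Z * \sum_j ka j - (\sum_(j < k) (a (wd j))%:Z) * De by rewrite -E2; ring.
have -> : s.+1%:Z = q.+1%:Z - (\sum_(j < k) (a (wd j))%:Z + (a ord_max)%:Z).
  by rewrite E3; ring.
ring.
Qed.

(** * Barycentric frames of a simplex *)

Section Dot.
Variables (R : rcfType) (d : nat).
Implicit Types x y z : 'rV[R]_d.

Lemma dotE x y : dot x y = (x *m y^T) 0 0.
Proof. by rewrite mxE; apply: eq_bigr => i _; rewrite mxE. Qed.

Lemma dotC x y : dot x y = dot y x.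
Proof. by apply: eq_bigr => i _; rewrite mulrC. Qed.

Lemma dotDr x y z : dot x (y + z) = dot x y + dot x z.
Proof. by rewrite -big_split; apply: eq_bigr => i _; rewrite mxE mulrDr. Qed.

Lemma dotZr a x y : dot x (a *: y) = a * dot x y.
Proof. by rewrite mulr_sumr; apply: eq_bigr => i _; rewrite mxE mulrCA. Qed.

Lemma dotNr x y : dot x (- y) = - dot x y.
Proof. by rewrite -scaleN1r dotZr mulN1r. Qed.

Lemma dotBr x y z : dot x (y - z) = dot x y - dot x z.
Proof. by rewrite dotDr dotNr. Qed.

Lemma dot0r x : dot x 0 = 0.
Proof. by rewrite -(scale0r 0) dotZr mul0r. Qed.

Lemma dotDl x y z : dot (x + y) z = dot x z + dot y z.
Proof. by rewrite ![dot _ z]dotC dotDr. Qed.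

Lemma dotZl a x y : dot (a *: x) y = a * dot x y.
Proof. by rewrite ![dot _ y]dotC dotZr. Qed.

Lemma dotNl x y : dot (- x) y = - dot x y.
Proof. by rewrite ![dot _ y]dotC dotNr. Qed.

Lemma dotBl x y z : dot (x - y) z = dot x z - dot y z.
Proof. by rewrite dotDl dotNl. Qed.

Lemma dot_sumr (I : Type) (s : seq I) (P : pred I) (F : I -> 'rV[R]_d) x :
  dot x (\sum_(i <- s | P i) F i) = \sum_(i <- s | P i) dot x (F i).
Proof. exact: (big_morph (dot x) (dotDr x) (dot0r x)). Qed.

Lemma dot_suml (I : Type) (s : seq I) (P : pred I) (F : I -> 'rV[R]_d) x :
  dot (\sum_(i <- s | P i) F i) x = \sum_(i <- s | P i) dot (F i) x.
Proof. by rewrite dotC dot_sumr; apply: eq_bigr => i _; rewrite dotC. Qed.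

Lemma dot_mulmx x y (A : 'M[R]_d) : dot (x *m A) y = dot x (y *m A^T).
Proof. by rewrite !dotE trmx_mul trmxK mulmxA. Qed.

Lemma dot_delta x i : dot x (delta_mx 0 i) = x 0 i.
Proof.
rewrite /dot (bigD1 i) //= !mxE !eqxx mulr1 big1 ?addr0 // => j ji.
by rewrite mxE (negPf ji) mulr0.
Qed.

Lemma dot_self_ge0 x : 0 <= dot x x.
Proof. by apply: sumr_ge0 => i _; rewrite -expr2 sqr_ge0. Qed.

Lemma dot_self_eq0 x : dot x x = 0 -> x = 0.
Proof.
move=> /eqP; rewrite psumr_eq0 => [/allP H|i _]; last by rewrite -expr2 sqr_ge0.
apply/rowP => i; rewrite mxE; have /implyP/(_ isT) := H i (mem_index_enum i).
by rewrite -expr2 sqrf_eq0 => /eqP.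
Qed.

Lemma mulmx_tr_dot (m n : nat) (A : 'M[R]_(m, d)) (B : 'M[R]_(n, d)) i j :
  (A *m B^T) i j = dot (row i A) (row j B).
Proof. by rewrite mxE; apply: eq_bigr => k _; rewrite !mxE. Qed.

End Dot.

(** * Integral scalars and integral points *)

Section Integrality.
Variable R : rcfType.

Definition intR (x : R) := exists z : int, x = z%:~R.

Lemma intR_int z : intR z%:~R. Proof. by exists z. Qed.
Lemma intR_nat n : intR n%:R. Proof. by exists n%:Z; rewrite -pmulrn. Qed.
Lemma intRD x y : intR x -> intR y -> intR (x + y).
Proof. by move=> [a ->] [b ->]; exists (a + b); rewrite intrD. Qed.
Lemma intRN x : intR x -> intR (- x).
Proof. by move=> [a ->]; exists (- a); rewrite mulrNz. Qed.
Lemma intRM x y : intR x -> intR y -> intR (x * y).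
Proof. by move=> [a ->] [b ->]; exists (a * b); rewrite intrM. Qed.
Lemma intR_sum (I : Type) (s : seq I) (P : pred I) (F : I -> R) :
  (forall i, P i -> intR (F i)) -> intR (\sum_(i <- s | P i) F i).
Proof. by move=> H; apply: (big_ind intR) => //; [exact: (intR_nat 0)|exact: intRD]. Qed.

Lemma intR_norm_ge1 x : intR x -> x != 0 -> 1 <= `|x|.
Proof.
move=> [z ->]; rewrite intr_eq0 -intr_norm => z0.
by rewrite ler1z -gtz0_ge1 normr_gt0.
Qed.

Lemma intR_mx m n (A : 'M[R]_(m, n)) : (forall i j, intR (A i j)) ->
  exists Z : 'M[int]_(m, n), A = map_mx intr Z.
Proof.
move=> H.
have /fin_all_exists[f fE] : forall ij : 'I_m * 'I_n, exists z : int, A ij.1 ij.2 = z%:~R.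
  by move=> [i j]; apply: H.
exists (\matrix_(i, j) f (i, j)); apply/matrixP => i j; rewrite !mxE.
exact: (fE (i, j)).
Qed.

Lemma intR_det n (A : 'M[R]_n) : (forall i j, intR (A i j)) -> intR (\det A).
Proof. by move=> /intR_mx[Z ->]; exists (\det Z); rewrite det_map_mx. Qed.

Variable d : nat.
Implicit Types x y z : 'rV[R]_d.

Lemma integralP x : integral x <-> forall k, intR (x 0 k).
Proof.
split=> [[z ->] k|H]; first by rewrite mxE; apply: intR_int.
have [Z xE] : exists Z : 'rV[int]_d, x = map_mx intr Z.
  by apply: intR_mx => i j; rewrite ord1.
by exists Z; rewrite xE; apply/rowP => k; rewrite !mxE.
Qed.

Lemma integral_pt0 : integral (0 : 'rV[R]_d).
Proof. by apply/integralP => k; rewrite mxE; exact: (intR_nat 0). Qed.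

Lemma integral_ptD x y : integral x -> integral y -> integral (x + y).
Proof.
move=> /integralP Hx /integralP Hy; apply/integralP => k; rewrite mxE.
exact: intRD.
Qed.

Lemma integral_ptZ a x : intR a -> integral x -> integral (a *: x).
Proof.
move=> Ha /integralP Hx; apply/integralP => k; rewrite mxE; exact: intRM.
Qed.

Lemma integral_ptN x : integral x -> integral (- x).
Proof. by rewrite -scaleN1r; apply: integral_ptZ; exists (-1). Qed.

Lemma integral_pt_sum (I : Type) (s : seq I) (P : pred I) (F : I -> 'rV[R]_d) :
  (forall i, P i -> integral (F i)) -> integral (\sum_(i <- s | P i) F i).
Proof.
move=> H; apply: (big_ind (@integral R d)) => //; [exact: integral_pt0|exact: integral_ptD].
Qed.

Lemma integral_delta i : integral (delta_mx 0 i : 'rV[R]_d).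
Proof. by apply/integralP => k; rewrite mxE; apply: intR_nat. Qed.

Lemma intR_dot x y : integral x -> integral y -> intR (dot x y).
Proof.
move=> /integralP Hx /integralP Hy; apply: intR_sum => i _; exact: intRM.
Qed.

End Integrality.

Section Conv.
Variables (R : rcfType) (d : nat).

Lemma conv_finP m (v : 'I_m -> 'rV[R]_d) x :
  conv (fun y => exists i, y = v i) x <->
  exists c : 'I_m -> R,
    [/\ forall i, 0 <= c i, \sum_i c i = 1 & x = \sum_i c i *: v i].
Proof.
split=> [[n [lam [p [pv [l0 [l1 ->]]]]]]|[c [c0 c1 ->]]]; last first.
  by exists m, c, v; split=> // i; exists i.
have [f fE] := fin_all_exists pv.
exists (fun i => \sum_(j | f j == i) lam j); split.
- by move=> i; apply: sumr_ge0.
- by rewrite -l1 [RHS](partition_big f predT).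
rewrite [LHS](partition_big f predT) //=; apply: eq_bigr => i _.
by rewrite scaler_suml; apply: eq_bigr => j /eqP <-; rewrite fE.
Qed.

End Conv.

Section Frame.
Variables (R : rcfType) (d : nat).
Local Notation pt := 'rV[R]_d.

(* [beta i + dot (q i) x] is the i-th barycentric coordinate of [x] with respect
   to the vertices [v]; in particular [beta] are the coordinates of the origin. *)
Definition frame (S : pt -> Prop) (v q : 'I_d.+1 -> pt) (beta : 'I_d.+1 -> R) :=
  (forall i j, dot (q i) (v j) + beta i = (i == j)%:R) /\
  (forall x, S x <-> forall i, 0 <= beta i + dot (q i) x).

(** Homogeneous coordinates: the extra column turns the affine relations of a frame into one
    identity between matrices inverse to each other up to transposition. *)
Definition hat (a : 'I_d.+1 -> R) (v : 'I_d.+1 -> pt) : 'M[R]_(d.+1, 1 + d) :=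
  row_mx (\col_i a i) (\matrix_i v i).

Section FrameTheory.
Variables (S : pt -> Prop) (v q : 'I_d.+1 -> pt) (beta : 'I_d.+1 -> R).
Hypothesis Sfr : frame S v q beta.

Lemma frame_dot i j : dot (q i) (v j) = (i == j)%:R - beta i.
Proof. by rewrite -(Sfr.1 i j) addrK. Qed.

Lemma frame_hat : hat (fun=> 1) v *m (hat beta q)^T = 1%:M.
Proof.
apply/matrixP => i j; rewrite /hat tr_row_mx mul_row_col mxE [RHS]mxE.
rewrite [X in _ + X]mulmx_tr_dot !rowK dotC frame_dot mxE big_ord_recl big_ord0 !mxE.
by rewrite eq_sym; ring.
Qed.

(** A one-sided inverse of a square matrix is two-sided; the four blocks of the reversed product are
    the four identities. *)
Lemma frame_block :
  [/\ \sum_i beta i = 1, \sum_i beta i *: v i = 0, \sum_i q i = 0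
    & (\matrix_i q i)^T *m (\matrix_i v i) = 1%:M].
Proof.
have := mulmx1C (frame_hat : (hat _ v : 'M_(1 + d)) *m _ = 1%:M).
rewrite /hat tr_row_mx mul_col_row scalar_mx_block => /eq_block_mx[E1 E2 E3 E4].
split.
- move/matrixP/(_ 0 0): E1; rewrite !mxE mulr1n => <-.
  by apply: eq_bigr => i _; rewrite !mxE mulr1.
- apply/rowP => k; move/matrixP/(_ 0 k): E2; rewrite !mxE summxE => E; rewrite -[RHS]E.
  by apply: eq_bigr => i _; rewrite !mxE.
- apply/rowP => k; move/matrixP/(_ k 0): E3; rewrite !mxE summxE => E; rewrite -[RHS]E.
  by apply: eq_bigr => i _; rewrite !mxE mulr1.
exact: E4.
Qed.

Lemma frame_sum_beta : \sum_i beta i = 1. Proof. by case: frame_block. Qed.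
Lemma frame_origin : \sum_i beta i *: v i = 0. Proof. by case: frame_block. Qed.
Lemma frame_sum_q : \sum_i q i = 0. Proof. by case: frame_block. Qed.

Lemma frame_decomp x : \sum_i dot (q i) x *: v i = x.
Proof.
case: frame_block => _ _ _ E; rewrite -[RHS]mulmx1 -E mulmxA.
apply/rowP => k; rewrite summxE mxE; apply: eq_bigr => i _.
by rewrite mulmx_tr_dot rowK row_id !mxE dotC.
Qed.

Lemma frame_dual_decomp x : \sum_i dot (v i) x *: q i = x.
Proof.
case: frame_block => _ _ _ /(congr1 trmx).
rewrite trmx_mul trmxK trmx1 => E; rewrite -[RHS]mulmx1 -E mulmxA.
apply/rowP => k; rewrite summxE mxE; apply: eq_bigr => i _.
by rewrite mulmx_tr_dot rowK row_id !mxE dotC.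
Qed.

(** Cramer's rule for the integral matrix [hat (fun=> 1) v]: its determinant is a common
    denominator. *)
Lemma frame_den : (forall i, integral (v i)) ->
  exists N : nat, [/\ (0 < N)%N, forall i, intR (N%:R * beta i)
    & forall i, integral (N%:R *: q i)].
Proof.
move=> vint; pose V : 'M[R]_(1 + d) := hat (fun=> 1) v.
pose Q : 'M[R]_(1 + d) := (hat beta q)^T.
have VQ : V *m Q = 1%:M by apply: frame_hat.
have [Z ZE] : exists Z : 'M[int]_(1 + d), V = map_mx intr Z.
  apply: intR_mx => i j; rewrite /V /hat mxE; case: splitP => k _; rewrite mxE.
    exact: (intR_nat _ 1).
  by have /integralP := vint i; apply.
have D : map_mx intr (\adj Z) = (\det Z)%:~R *: Q.
  have := mul_adj_mx V; rewrite ZE -map_mx_adj det_map_mx -ZE => /(congr1 (mulmx^~ Q)).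
  by rewrite -mulmxA VQ mulmx1 mul_scalar_mx.
have Z0 : \det Z != 0.
  apply/eqP => Z0; move: (congr1 determinant VQ).
  by rewrite det_mulmx ZE det_map_mx Z0 mul0r det1 => /eqP; rewrite eq_sym oner_eq0.
have QN i j : intR (`|\det Z|%N%:R * Q i j).
  have -> : (`|\det Z|%N)%:R = (sgz (\det Z) * \det Z)%:~R :> R.
    by rewrite -abszEsg pmulrn.
  rewrite intrM -mulrA; apply: intRM (intR_int _ _) _.
  by have /matrixP/(_ i j) := D; rewrite !mxE => <-; apply: intR_int.
exists `|\det Z|%N; split; first by rewrite absz_gt0.
- move=> i; have := QN (lshift d 0) i.
  by rewrite /Q /hat !mxE (unsplitK (inl _)) mxE.
- move=> i; apply/integralP => k; have := QN (rshift 1 k) i.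
  by rewrite /Q /hat !mxE (unsplitK (inr _)) mxE.
Qed.

Lemma frame_perm (s : 'S_d.+1) :
  frame S (fun i => v (s i)) (fun i => q (s i)) (fun i => beta (s i)).
Proof.
split=> [i j|x]; first by rewrite Sfr.1 (inj_eq perm_inj).
rewrite Sfr.2; split=> H i; first exact: H.
by have := H (s^-1%g i); rewrite permKV.
Qed.

Lemma frame_interior x : (forall i, 0 < beta i + dot (q i) x) -> interior S x.
Proof.
move=> x0.
pose B : R := 1 + \sum_i \sum_k `|q i 0 k|.
pose g i := beta i + dot (q i) x.
have [m m0 mg] : exists2 m : R, 0 < m & forall i, m <= g i.
  have : exists2 m : R, 0 < m & forall i, i \in enum 'I_d.+1 -> m <= g i.
    elim: (enum _) => [|i s [m m0 IH]]; first by exists 1.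
    exists (Num.min m (g i)); first by rewrite lt_min m0 x0.
    move=> j; rewrite inE => /predU1P[->|js]; first by rewrite ge_min lexx orbT.
    by rewrite ge_min IH.
  by case=> m m0 H; exists m => // i; apply: H; rewrite mem_enum.
have B0 : 0 < B.
  by rewrite ltr_pwDl // sumr_ge0 // => i _; rewrite sumr_ge0.
exists (m / B); split=> [|y yx]; first by rewrite divr_gt0.
have yk k : `|y 0 k - x 0 k| <= m / B.
  have mB : 0 <= m / B by rewrite divr_ge0 // ltW.
  rewrite -(@ler_pXn2r _ 2) ?nnegrE ?normr_ge0 //.
  rewrite -normrX ger0_norm ?sqr_ge0 //; apply: le_trans (ltW yx).
  by rewrite (bigD1 k) //= lerDl sumr_ge0 // => j _; rewrite sqr_ge0.
apply/Sfr.2 => i; have -> : y = x + (y - x) by rewrite addrC subrK.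
rewrite dotDr addrA -/(g i).
suff : `|dot (q i) (y - x)| <= m.
  by rewrite ler_norml => /andP[H _]; have := mg i; lra.
have -> : m = B * (m / B) by rewrite mulrC divfK // gt_eqF.
apply: le_trans (ler_norm_sum _ _ _) _.
apply: (@le_trans _ _ ((\sum_k `|q i 0 k|) * (m / B))).
  rewrite mulr_suml; apply: ler_sum => k _; rewrite normrM ler_wpM2l //.
  by rewrite !mxE yk.
apply: ler_wpM2r; first by rewrite divr_ge0 // ltW.
rewrite /B [X in _ <= 1 + X](bigD1 i) //= addrCA lerDl addr_ge0 // sumr_ge0 // => j _.
by rewrite sumr_ge0.
Qed.

Hypothesis d_gt0 : (0 < d)%N.

Lemma frame_q_neq0 i : q i != 0.
Proof.
apply/eqP => q0.
have [j ij] : exists j, i != j.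
  have : (1 < #|'I_d.+1|)%N by rewrite card_ord.
  rewrite (cardD1 i) inE /= => /card_gt0P[j]; rewrite !inE => /andP[ji _].
  by exists j; rewrite eq_sym.
have := frame_dot i i; have := frame_dot i j.
by rewrite q0 ![dot 0 _]dotC !dot0r eqxx (negPf ij) /=; lra.
Qed.

(** Moving along [- q i] lowers the [i]-th barycentric coordinate by a positive multiple of
    [|q i|^2], so this coordinate is positive at [x]. *)
Lemma frame_algebraic_interior x :
  (forall z, exists2 e : R, 0 < e & S (x + e *: z)) ->
  forall i, 0 < beta i + dot (q i) x.
Proof.
move=> H i; have [e e0 /Sfr.2/(_ i)] := H (- q i).
rewrite dotDr dotZr dotNr.
have : 0 < dot (q i) (q i).
  by rewrite lt_def dot_self_ge0 andbT; apply: contra_neq (@dot_self_eq0 _ _ _) (frame_q_neq0 i).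
nra.
Qed.

End FrameTheory.

Lemma interior_algebraic (S : pt -> Prop) x : interior S x ->
  forall z, exists2 e : R, 0 < e & S (x + e *: z).
Proof.
move=> [e [e0 H]] z; pose B := 1 + \sum_k (z 0 k) ^+ 2.
have s0 : 0 <= \sum_k (z 0 k) ^+ 2 by apply: sumr_ge0 => k _; apply: sqr_ge0.
have B0 : 0 < B by rewrite ltr_pwDl.
exists (e / B); first by rewrite divr_gt0.
apply: H; rewrite (eq_bigr (fun k => (e / B) ^+ 2 * z 0 k ^+ 2)); last first.
  by move=> k _; rewrite !mxE [x 0 k + _]addrC addrK exprMn.
rewrite -mulr_sumr exprMn -mulrA gtr_pMr ?exprn_gt0 //.
rewrite exprVn mulrC ltr_pdivrMr ?exprn_gt0 // mul1r.
by rewrite /B; move: (\sum_k _) s0 => t t0; nra.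
Qed.

Lemma frame_exists (S : pt -> Prop) : lattice_simplex S ->
  exists v q beta, (forall i, integral (v i)) /\ frame S v q beta.
Proof.
move=> [v [vint [vfree vS]]].
pose V : 'M[R]_(1 + d) := hat (fun=> 1) v.
have VU : V \in unitmx.
  rewrite -row_free_unit; apply: inj_row_free => c /rowP cV.
  have c0 : \sum_i c 0 i = 0.
    have := cV (lshift d 0); rewrite [RHS]mxE mxE => E; rewrite -[RHS]E.
    by apply: eq_bigr => i _; rewrite /V /hat mxE (unsplitK (inl _)) mxE mulr1.
  have cv : \sum_i c 0 i *: v i = 0.
    apply/rowP => k; have := cV (rshift 1 k); rewrite [RHS]mxE mxE => E; rewrite [RHS]mxE -[RHS]E.
    rewrite summxE; apply: eq_bigr => i _.
    by rewrite /V /hat !mxE (unsplitK (inr _)) mxE.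
  have c1 : (\row_i c 0 (lift ord0 i) : 'rV_d) = 0.
    apply: (row_free_inj vfree); rewrite mul0mx mulmx_sum_row.
    rewrite -[RHS]cv big_ord_recl /=.
    have -> : c 0 ord0 = - \sum_(i < d) c 0 (lift ord0 i).
      by move: c0; rewrite big_ord_recl => /eqP; rewrite addr_eq0 => /eqP.
    rewrite scaleNr scaler_suml -sumrN -big_split /=; apply: eq_bigr => i _.
    by rewrite rowK mxE scalerBr addrC.
  have c1i i : c 0 (lift ord0 i) = 0 by move/rowP/(_ i): c1; rewrite !mxE.
  apply/rowP => i; rewrite mxE; case: (unliftP ord0 i) => [j ->|->]; first exact: c1i.
  by move: c0; rewrite big_ord_recl big1 ?addr0 // => j _; apply: c1i.
pose Q := (invmx V)^T : 'M[R]_(d.+1, 1 + d).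
pose beta i := Q i (lshift d 0).
pose q i : pt := \row_k Q i (rshift 1 k).
have hQ : hat beta q = Q.
  apply/matrixP => i j; rewrite /hat -[j]splitK; case: (split j) => k /=.
    by rewrite row_mxEl [LHS]mxE ord1.
  by rewrite row_mxEr [LHS]mxE /q [LHS]mxE.
have fr1 i j : dot (q i) (v j) + beta i = (i == j)%:R.
  have := mulmxV VU; rewrite -[invmx V]trmxK -/Q -hQ => /matrixP/(_ j i).
  rewrite {1}/V /hat tr_row_mx mul_row_col mxE [RHS]mxE eq_sym => <-.
  rewrite [X in _ = _ + X]mulmx_tr_dot !rowK [X in _ = X + _]mxE big_ord_recl big_ord0 !mxE.
  by rewrite mul1r addr0 addrC dotC.
exists v, q, beta; split=> //; split=> // x.
have frT : frame (fun x => forall i, 0 <= beta i + dot (q i) x) v q beta by [].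
rewrite vS conv_finP; split=> [[c [c0 c1 ->]] i|H].
  rewrite dot_sumr (eq_bigr (fun j => c j * (i == j)%:R - c j * beta i)).
    rewrite sumrB -mulr_suml c1 mul1r (bigD1 i) //= eqxx mulr1 big1 ?addr0.
      by rewrite addrC subrK.
    by move=> j /negPf ji; rewrite eq_sym ji mulr0.
  by move=> j _; rewrite dotZr (frame_dot frT) mulrBr.
exists (fun i => beta i + dot (q i) x); split=> //.
  by rewrite big_split /= (frame_sum_beta frT) -dot_suml (frame_sum_q frT) dotC dot0r addr0.
under eq_bigr do rewrite scalerDl.
by rewrite big_split /= (frame_origin frT) (frame_decomp frT) add0r.
Qed.

Lemma sort_perm_exists n (b : 'I_n -> R) :
  exists s : 'S_n, forall i j : 'I_n, (i <= j)%N -> b (s j) <= b (s i).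
Proof.
case: n b => [|n] b; first by exists 1%g => -[].
pose r (i j : 'I_n.+1) := b j <= b i.
pose t := sort r (enum 'I_n.+1).
have st : size t = n.+1 by rewrite size_sort size_enum_ord.
have ut : uniq t by rewrite sort_uniq enum_uniq.
have inj : injective (fun i : 'I_n.+1 => nth ord0 t i).
  by move=> i j /eqP; rewrite nth_uniq ?st // => /eqP/val_inj.
exists (perm inj) => i j ij; rewrite !permE.
have tr : transitive r by move=> y x z xy yz; apply: le_trans yz xy.
have srt : sorted r t by apply: sort_sorted => x y; apply: le_total.
by apply: (sorted_leq_nth tr _ _ srt) => //; rewrite ?inE ?st //; move=> x; apply: lexx.
Qed.

Lemma sorted_frame_exists (S : pt -> Prop) : lattice_simplex S ->
  exists v q beta, [/\ forall i, integral (v i), frame S v q beta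
    & forall i j : 'I_d.+1, (i <= j)%N -> beta j <= beta i].
Proof.
move=> /frame_exists[v [q [b [vint fr]]]].
have [s sb] := sort_perm_exists b.
by exists (fun i => v (s i)), (fun i => q (s i)), (fun i => b (s i)); split=> //;
  apply: frame_perm.
Qed.

End Frame.

(** * The product-sum inequality for the barycentric coordinates of the origin *)

Section ProductSumInequality.
Variables (R : rcfType) (d : nat) (S : 'rV[R]_d -> Prop).
Variables (v q : 'I_d.+1 -> 'rV[R]_d) (beta : 'I_d.+1 -> R).
Hypothesis Sfr : frame S v q beta.
Hypothesis vint : forall i, integral (v i).
Hypothesis beta_gt0 : forall i, 0 < beta i.
Hypothesis int_uniq :
  forall x, integral x -> (forall i, 0 < beta i + dot (q i) x) -> x = 0.

(* The shifts [zeta] are representatives of distinct classes modulo the lattice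
   spanned by the first k+1 vertices: each further class gains one factor. *)
Lemma product_sum_shifted k (kd : (k.+1 <= d.+1)%N) h (zeta : 'I_h -> 'rV[R]_d) :
  (k < d)%N ->
  (forall e, integral (zeta e)) ->
  (forall e, exists mu : 'I_k.+1 -> R,
     zeta e = \sum_i mu i *: v (widen_ord kd i)) ->
  (forall e e', e <> e' -> forall m : 'I_k.+1 -> int,
     zeta e - zeta e' <> \sum_i (m i)%:~R *: v (widen_ord kd i)) ->
  h%:R * \prod_i beta (widen_ord kd i) <= 1 - \sum_i beta (widen_ord kd i).
Proof.
move=> kd' zint zspan zdist; pose wd := widen_ord kd.
rewrite leNgt; apply/negP => lt.
(* After scaling by [N], the coordinates of the first [k+1] vertices form, up to sign, the matrix
   [a 1^T - q I] of [box_collision], with [a i = N * beta i], [q = N] and [s] equal to [N] times the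
   remaining weight. *)
have [N [N0 Nb Nq]] := frame_den Sfr vint.
have NR0 : 0 < N%:R :> R by rewrite ltr0n.
have posnat (x : R) : intR x -> 0 < x -> exists n : nat, x = n%:R.
  move=> [z ->]; rewrite ltr0z; case: z => // n _; exists n; by rewrite pmulrn.
have T0 : 0 < 1 - \sum_i beta (wd i).
  rewrite -(frame_sum_beta Sfr) (bigID (fun i : 'I_d.+1 => (i < k.+1)%N)) /=.
  rewrite (big_ord_narrow kd) addrC addrK (bigD1 ord_max) /=; last by rewrite -leqNgt.
  by rewrite ltr_wpDr // sumr_ge0 // => i _; apply: ltW.
have /fin_all_exists[a aE] : forall i, exists n : nat, N%:R * beta (wd i) = n%:R.
  by move=> i; apply: posnat; rewrite ?mulr_gt0.
have [s sE] : exists s : nat, N%:R * (1 - \sum_i beta (wd i)) = s%:R.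
  apply: posnat; last by rewrite mulr_gt0.
  rewrite mulrBr mulr1 mulr_sumr; apply: intRD (intR_nat _ _) _; apply: intRN.
  by apply: intR_sum.
have s0 : (0 < s)%N by rewrite -(ltr0n R) -sE mulr_gt0.
have qE : (\sum_i a i + s = N)%N.
  apply/eqP; rewrite -(eqr_nat R) natrD natr_sum -sE; apply/eqP.
  rewrite (eq_bigr (fun i => N%:R * beta (wd i))) => [|i _]; last by rewrite aE.
  by rewrite -mulr_sumr; ring.
have ltN : (s * N ^ k < h * \prod_i a i)%N.
  rewrite -(ltr_nat R) !natrM natr_prod natrX.
  rewrite (eq_bigr (fun i => N%:R * beta (wd i))) => [|i _]; last by rewrite aE.
  rewrite -sE big_split /= prodr_const card_ord mulrAC -exprS mulrCA.
  by rewrite ltr_pM2l ?exprn_gt0.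
have /fin_all_exists[g gE] : forall ei : 'I_h * 'I_k.+1, exists z : int,
    - (N%:R * dot (q (wd ei.2)) (zeta ei.1)) = z%:~R.
  move=> [e i]; rewrite -dotZl; apply: intRN; exact: intR_dot.
have [e [e' [f [f' [m [fa f'a ne E]]]]]] :=
  @box_collision k N s h a (fun e i => g (e, i)) s0 qE ltN.
pose xm := \sum_i (m i)%:~R *: v (wd i).
pose X := zeta e - zeta e' - xm.
have Xint : integral X.
  apply: integral_ptD; first by apply: integral_ptD => //; apply: integral_ptN.
  by apply/integral_ptN/integral_pt_sum => i _; apply: integral_ptZ => //; apply: intR_int.
have dspan (mu : 'I_k.+1 -> R) j : dot (q j) (\sum_i mu i *: v (wd i)) =
    (\sum_(i | wd i == j) mu i) - beta j * \sum_i mu i.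
  rewrite dot_sumr mulr_sumr [X in _ = X - _]big_mkcond -sumrB /=.
  apply: eq_bigr => i _; rewrite dotZr (frame_dot Sfr) [wd i == j]eq_sym.
  by case: (j == wd i) => /=; ring.
have din (mu : 'I_k.+1 -> R) i : \sum_(j | wd j == wd i) mu j = mu i.
  by rewrite (big_pred1 i) // => j /=; rewrite -val_eqE.
have [mu muE] : exists mu : 'I_k.+1 -> R, X = \sum_i mu i *: v (wd i).
  have [m1 E1] := zspan e; have [m2 E2] := zspan e'.
  exists (fun i => m1 i - m2 i - (m i)%:~R).
  by rewrite /X E1 E2 /xm -!sumrB; apply: eq_bigr => i _; rewrite !scalerBl.
have XE i : N%:R * dot (q (wd i)) X = (f i)%:~R - (f' i)%:~R.
  have := congr1 (fun z : int => z%:~R : R) (E i).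
  rewrite !(intrD, mulrNz, intrM) -!gE /= -!pmulrn -aE (rmorph_sum (intr : int -> R)) /=.
  rewrite /X !dotBr /xm dspan din.
  move: (\sum_j _) => t; move: (dot _ (zeta e)) (dot _ (zeta e')) => A B H.
  have -> : (f i)%:~R - (f' i)%:~R = ((f i)%:~R - (f' i)%:~R +
    (- (N%:R * A) - - (N%:R * B))) + N%:R * (A - B) :> R by ring.
  by rewrite H; ring.
have Xlt i : `|dot (q (wd i)) X| < beta (wd i).
  rewrite -(ltr_pM2l NR0) -{1}(gtr0_norm NR0) -normrM XE aE.
  have /andP[f0 f1] := fa i; have /andP[f0' f1'] := f'a i.
  have : -(a i)%:Z < f i - f' i < (a i)%:Z by lia.
  by rewrite ltr_norml -intrB -!(ltr_int R) mulrNz -!pmulrn.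
(* Beyond the first [k+1] indices the coordinates of [X] are one common multiple of the weights, so
   [X] or [- X] is nonnegative there. The bounds [Xlt] on the first coordinates make that point
   interior to [S], hence 0. *)
have X0 : X = 0.
  have out (j : 'I_d.+1) : ~~ (j < k.+1)%N -> dot (q j) X = - (beta j * \sum_i mu i).
    move=> jk; rewrite muE dspan big_pred0 ?sub0r // => i.
    by apply/negbTE; apply: contra jk => /eqP <-; rewrite /= ltn_ord.
  have inn (j : 'I_d.+1) : (j < k.+1)%N -> `|dot (q j) X| < beta j.
    move=> jk; have := Xlt (Ordinal jk).
    by have -> : wd (Ordinal jk) = j by apply/val_inj.
  case: (lerP (\sum_i mu i) 0) => t0.
    apply: int_uniq => // j; have bj := beta_gt0 j; case: (boolP (j < k.+1)%N) => jk.
      by have := inn j jk; rewrite ltr_norml => /andP[H _]; lra.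
    by rewrite out //; nra.
  apply/eqP; rewrite -oppr_eq0; apply/eqP.
  apply: int_uniq => [|j]; first exact: integral_ptN.
  rewrite dotNr; have bj := beta_gt0 j; case: (boolP (j < k.+1)%N) => jk.
    by have := inn j jk; rewrite ltr_norml => /andP[_ H]; lra.
  by rewrite out //; nra.
case: ne => [/zdist/(_ m)|[i]]; first by apply; apply/eqP; rewrite -subr_eq0 -/xm -/X X0.
have := XE i; rewrite X0 dot0r mulr0 => /eqP; rewrite eq_sym subr_eq0 eqr_int.
by move=> /eqP.
Qed.

Lemma product_sum k : (k <= d)%N ->
  \prod_(0 <= i < k) beta (inord i) <= 1 - \sum_(0 <= i < k) beta (inord i).
Proof.
case: k => [|k] kd; first by rewrite !big_nil subr0.
have kd1 : (k.+1 <= d.+1)%N by rewrite ltnW.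
have wE (i : 'I_k.+1) : beta (inord i) = beta (widen_ord kd1 i).
  by congr beta; apply/val_inj; rewrite /= inordK // (leq_trans (ltn_ord i)).
rewrite !big_mkord [X in X <= _](eq_bigr (fun i => beta (widen_ord kd1 i))) //.
rewrite [X in _ <= 1 - X](eq_bigr (fun i => beta (widen_ord kd1 i))) //.
rewrite -[X in X <= _]mul1r.
apply: (@product_sum_shifted k kd1 1 (fun=> 0)) => // [_|_|e e' ee'].
- exact: integral_pt0.
- by exists (fun=> 0); rewrite big1 // => i _; rewrite scale0r.
- by case: ee'; rewrite !ord1.
Qed.

End ProductSumInequality.

(** * Faces of the polar simplex *)

Section Gram.
Variable R : rcfType.

(* [t I + (1 - t) B B^T] is nonsingular for t in [0, 1], so its determinant
   keeps the sign that it has at t = 1. *)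
Lemma gram_det_gt0 m n (B : 'M[R]_(m, n)) : row_free B -> 0 < \det (B *m B^T).
Proof.
move=> Bfree; rewrite ltNge; apply/negP => det_le0; set G := B *m B^T in det_le0.
pose M : 'M[{poly R}]_m := 'X *: 1%:M + (1 - 'X) *: map_mx polyC G.
have ME t : (\det M).[t] = \det (t *: 1%:M + (1 - t) *: G).
  rewrite -horner_evalE -det_map_mx; congr (\det _); apply/matrixP => i j.
  rewrite !mxE /= horner_evalE !hornerE.
  by case: (i == j); rewrite ?mulr1n ?mulr0n !hornerE.
have [||t /andP[t0 t1]] := @poly_ivt R (\det M) 0 1.
- exact: ler01.
- rewrite !ME scale0r add0r subr0 scale1r det_le0 /= scale1r subrr scale0r addr0.
  by rewrite det1 ler01.
rewrite /root ME => /det0P[c c0 cE].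
have : ((c *m (t *: 1%:M + (1 - t) *: G)) *m c^T) 0 0 = 0 by rewrite cE mul0mx mxE.
rewrite mulmxDr -!scalemxAr mulmx1 mulmxDl -!scalemxAl mxE [X in X + _]mxE [X in _ + X]mxE.
rewrite /G mulmxA -[c *m B *m _ *m _]mulmxA -trmx_mul -!dotE.
have p1 : 0 < dot c c.
  by rewrite lt_def dot_self_ge0 andbT; apply: contra_neq (@dot_self_eq0 _ _ _) c0.
have p2 : 0 < dot (c *m B) (c *m B).
  rewrite lt_def dot_self_ge0 andbT; apply: contra_neq c0 => /dot_self_eq0 H.
  by apply: (row_free_inj Bfree); rewrite mul0mx.
nra.
Qed.

Lemma sqrt_gram_mul l n (C : 'M[R]_l) (B : 'M[R]_(l, n)) :
  Num.sqrt (\det ((C *m B) *m (C *m B)^T)) = `|\det C| * Num.sqrt (\det (B *m B^T)).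
Proof.
rewrite trmx_mul mulmxA -(mulmxA C) !det_mulmx det_tr mulrAC -expr2.
by rewrite sqrtrM ?sqr_ge0 // sqrtr_sqr.
Qed.

End Gram.

Section Edges.
Variables (R : rcfType) (d l : nat).
Implicit Types w : 'I_l.+1 -> 'rV[R]_d.

Definition edges w (t : 'I_l.+1) := \matrix_(i < l) (w (lift t i) - w t).

Lemma edges_sum w t s :
  w s - w t = \sum_(r < l) (s == lift t r)%:R *: row r (edges w t).
Proof.
case: (unliftP t s) => [j ->|->].
  rewrite (bigD1 j) //= eqxx scale1r rowK big1 ?addr0 // => r rj.
  by rewrite (inj_eq (@lift_inj _ t)) eq_sym (negPf rj) scale0r.
by rewrite subrr big1 // => r _; rewrite (negPf (neq_lift _ _)) scale0r.
Qed.

Definition base_change (t s : 'I_l.+1) : 'M[R]_l :=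
  \matrix_(i, r) ((lift t i == lift s r)%:R - (t == lift s r)%:R).

Lemma edges_base_change w t s : edges w t = base_change t s *m edges w s.
Proof.
apply/row_matrixP => i; rewrite row_mul mulmx_sum_row rowK.
have -> : w (lift t i) - w t = (w (lift t i) - w s) - (w t - w s).
  by rewrite opprB addrA subrK.
rewrite !(edges_sum w s) -sumrB; apply: eq_bigr => r _.
by rewrite !mxE scalerBl.
Qed.

Lemma edges_free w t s : row_free (edges w t) -> row_free (edges w s).
Proof.
rewrite /row_free => /eqP H; rewrite eqn_leq rank_leq_row -{1}H.
by rewrite (edges_base_change w t s) mxrankM_maxr.
Qed.

(** The two changes of base vertex are integral and mutually inverse, so their determinants are
    units of the integers. *)
Lemma det_base_change w t s : row_free (edges w t) -> `|\det (base_change t s)| = 1.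
Proof.
move=> wfree.
have E : base_change t s *m base_change s t = 1%:M.
  apply: (row_free_inj wfree); rewrite mul1mx -mulmxA.
  by rewrite -edges_base_change -edges_base_change.
have := congr1 (fun M => `|\det M|) E; rewrite det_mulmx det1 normr1 normrM.
have bi (t' s' : 'I_l.+1) : intR (\det (base_change t' s')).
  by apply: intR_det => i j; rewrite mxE; apply: intRD (intR_nat _ _) (intRN (intR_nat _ _)).
have [z zE] := bi t s; have [z' zE'] := bi s t; rewrite zE zE' -!intr_norm -intrM.
move=> /eqP; rewrite -[1]/(1%:~R) eqr_int => /eqP H; congr _%:~R.
move: (normr_ge0 z) (normr_ge0 z') H; move: (`|z|) (`|z'|) => a b a0 b0 H.
have a1 : 1 <= a by nia.
have b1 : 1 <= b by nia.
have : 0 <= (a - 1) * (b - 1) by rewrite mulr_ge0 // subr_ge0.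
nia.
Qed.

Lemma conv_sub_edges w x y : conv (fun y => exists i, y = w i) x ->
  conv (fun y => exists i, y = w i) y -> (x - y <= edges w ord0)%MS.
Proof.
move=> /conv_finP[c [_ c1 ->]] /conv_finP[c' [_ c1' ->]].
have -> : \sum_i c i *: w i - \sum_i c' i *: w i =
    \sum_i (c i - c' i) *: (w i - w ord0).
  have -> : \sum_i (c i - c' i) *: (w i - w ord0) =
      \sum_i (c i *: w i - c' i *: w i) - \sum_i (c i - c' i) *: w ord0.
    by rewrite -sumrB; apply: eq_bigr => i _; rewrite scalerBr !scalerBl.
  by rewrite -scaler_suml !sumrB c1 c1' subrr scale0r subr0.
apply: summx_sub => i _; apply: scalemx_sub; rewrite (edges_sum w ord0).
by apply: summx_sub => r _; apply: scalemx_sub; apply: row_sub.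
Qed.

End Edges.

Section PolarFaces.
Variables (R : rcfType) (d : nat) (S : 'rV[R]_d -> Prop).
Variables (v q : 'I_d.+1 -> 'rV[R]_d) (beta : 'I_d.+1 -> R).
Hypothesis Sfr : frame S v q beta.
Hypothesis beta_gt0 : forall i, 0 < beta i.

(** The facet of [S] opposite [v i] has equation [beta i + dot (q i) x = 0], that is
    [dot (p i) x = 1]; this is the vertex of the polar dual to it. *)
Definition polar_vertex i := - (beta i)^-1 *: q i.
Local Notation p := polar_vertex.

Lemma dot_polar_vertex i j : dot (v j) (p i) = 1 - (i == j)%:R / beta i.
Proof.
rewrite dotZr dotC (frame_dot Sfr); have b0 := beta_gt0 i; field.
by rewrite gt_eqF.
Qed.

Lemma polarP y : polar S y <-> forall i, dot (v i) y <= 1.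
Proof.
split=> [H i|H x /Sfr.2 xS].
  by apply/H/Sfr.2 => j; rewrite (frame_dot Sfr) addrC subrK.
have c1 : \sum_i (beta i + dot (q i) x) = 1.
  by rewrite big_split /= (frame_sum_beta Sfr) -dot_suml (frame_sum_q Sfr) dotC dot0r addr0.
have -> : x = \sum_i (beta i + dot (q i) x) *: v i.
  under eq_bigr do rewrite scalerDl.
  by rewrite big_split /= (frame_origin Sfr) (frame_decomp Sfr) add0r.
rewrite dot_suml -c1; apply: ler_sum => i _; rewrite dotZl.
by rewrite -[X in _ <= X]mulr1 ler_wpM2l.
Qed.

Lemma polar_vertex_polar i : polar S (p i).
Proof.
apply/polarP => j; rewrite dot_polar_vertex gerBl.
by rewrite divr_ge0 // ltW.
Qed.

(** Barycentric coordinates with respect to the vertices of the polar simplex. *)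
Definition polar_bary y i := beta i * (1 - dot (v i) y).
Local Notation nu := polar_bary.

Lemma polar_bary_sum y : \sum_i nu y i = 1.
Proof.
rewrite /nu; under eq_bigr do rewrite mulrBr mulr1 -dotZl.
by rewrite sumrB -dot_suml (frame_origin Sfr) dotC dot0r subr0 (frame_sum_beta Sfr).
Qed.

Lemma polar_bary_decomp y : \sum_i nu y i *: p i = y.
Proof.
rewrite -[RHS](frame_dual_decomp Sfr).
have -> : \sum_i dot (v i) y *: q i = \sum_i (dot (v i) y *: q i - q i).
  by rewrite sumrB (frame_sum_q Sfr) subr0.
apply: eq_bigr => i _; rewrite /nu /p scalerA -[X in _ = _ - X]scale1r -scalerBl.
congr (_ *: _); have := beta_gt0 i => b0; field; by rewrite gt_eqF.
Qed.

Lemma polar_bary_ge0 y i : polar S y -> 0 <= nu y i.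
Proof. by move=> /polarP H; rewrite mulr_ge0 ?subr_ge0 // ltW. Qed.

(** [volZ] accepts any points [w] spanning the face, so these have to be recognised as polar
    vertices. A polar vertex on the supporting hyperplane is extreme, hence is some [w s].
    Conversely [w t] is a convex combination of such vertices, thus of points [w s], and affine
    independence leaves only terms equal to [w t]. *)
Lemma face_vertices F l (w : 'I_l.+1 -> 'rV[R]_d) :
  is_face (polar S) F -> (forall x, F x <-> conv (fun y => exists i, y = w i) x) ->
  row_free (edges w ord0) ->
  exists2 tau : 'I_l.+1 -> 'I_d.+1, injective tau & forall t, w t = p (tau t).
Proof.
move=> [a [b [ab Fab]]] Fw wfree0.
have wfree t : row_free (edges w t) by apply: edges_free wfree0.
have winj : injective w.
  move=> t s E; apply/eqP; apply: contraT => ts.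
  have [r sE] : exists r, s = lift t r.
    by case: (unliftP t s) ts => [r ->|->]; [exists r|rewrite eqxx].
  have : (delta_mx 0 r : 'rV[R]_l) = 0.
    apply: (row_free_inj (wfree t)); rewrite mul0mx -rowE rowK -sE E subrr //.
  by move=> /rowP/(_ r); rewrite !mxE !eqxx => /eqP; rewrite oner_eq0.
have Fwt t : F (w t).
  apply/Fw/conv_finP; exists (fun s => (s == t)%:R); split=> [s||].
  - by rewrite ler0n.
  - by rewrite (bigD1 t) //= eqxx big1 ?addr0 // => s /negPf ->.
  - rewrite (bigD1 t) //= eqxx scale1r big1 ?addr0 // => s /negPf ->.
    by rewrite scale0r.
pose I i := dot a (p i) == b.
have pb i : dot a (p i) <= b by apply/ab/polar_vertex_polar.
have nuI y i : F y -> nu y i != 0 -> I i.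
  move=> /Fab[yS yb] nui.
  have : \sum_j nu y j * (b - dot a (p j)) = 0.
    under eq_bigr do rewrite mulrBr -dotZr.
    by rewrite sumrB -dot_sumr polar_bary_decomp -mulr_suml polar_bary_sum mul1r yb subrr.
  move=> /eqP; rewrite psumr_eq0 => [/allP/(_ i (mem_index_enum i))/implyP/(_ isT)|j _].
    by rewrite mulf_eq0 (negPf nui) subr_eq0 eq_sym.
  by rewrite mulr_ge0 ?polar_bary_ge0 ?subr_ge0.
have Ip i : I i -> exists t, w t = p i.
  move=> /eqP Ii; have /Fw/conv_finP[c [c0 c1 pE]] : F (p i).
    by apply/Fab; split=> //; apply: polar_vertex_polar.
  have [t ct] : exists t, c t != 0.
    apply/existsP; apply: contraT => /existsPn H.
    move: c1; rewrite big1 => [/eqP|t _]; first by rewrite eq_sym oner_eq0.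
    by have := H t; rewrite negbK => /eqP.
  exists t.
  (* Extremality: [p i] satisfies [dot (v j) y = 1] for all [j != i], so every [w t] of nonzero
     weight does, and these equations determine [p i]. *)
  have vj j : j != i -> dot (v j) (w t) = 1.
    move=> ji; have : \sum_s c s * (1 - dot (v j) (w s)) = 0.
      under eq_bigr do rewrite mulrBr mulr1 -dotZr.
      rewrite sumrB -dot_sumr -pE c1 dot_polar_vertex eq_sym (negPf ji) mul0r.
      by rewrite subr0 subrr.
    have le1 s : dot (v j) (w s) <= 1 by have /Fab[/polarP] := Fwt s.
    move=> /eqP; rewrite psumr_eq0 => [/allP/(_ t (mem_index_enum t))/implyP/(_ isT)|s _].
      by rewrite mulf_eq0 (negPf ct) subr_eq0 eq_sym => /eqP.
    by rewrite mulr_ge0 // subr_ge0.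
  have nu0 j : j != i -> nu (w t) j = 0 by move=> /vj E; rewrite /nu E subrr mulr0.
  have nu1 : nu (w t) i = 1.
    by rewrite -(polar_bary_sum (w t)) (bigD1 i) //= big1 ?addr0.
  rewrite -[LHS]polar_bary_decomp (bigD1 i) //= nu1 scale1r big1 ?addr0 // => j ji.
  by rewrite nu0 // scale0r.
have /fin_all_exists[sg sgE] : forall i, exists t, I i -> w t = p i.
  move=> i; case: (boolP (I i)) => [/Ip[t E]|_]; first by exists t.
  by exists ord0.
have /fin_all_exists[tau tauE] : forall t, exists i, w t = p i.
  move=> t; have nu0 i : 0 <= nu (w t) i by apply: polar_bary_ge0; have /Fab[] := Fwt t.
  have wE : \sum_i nu (w t) i *: w (sg i) = w t.
    rewrite -[RHS]polar_bary_decomp; apply: eq_bigr => i _.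
    case: (eqVneq (nu (w t) i) 0) => [->|/nuI Ii]; first by rewrite !scale0r.
    by rewrite sgE //; apply: Ii.
  have cE : (\row_r \sum_(i | sg i == lift t r) nu (w t) i) = 0 :> 'rV[R]_l.
    apply: (row_free_inj (wfree t)); rewrite mul0mx mulmx_sum_row.
    rewrite (eq_bigr (fun r => \sum_i nu (w t) i *: ((sg i == lift t r)%:R *: row r (edges w t)))).
      rewrite exchange_big /=.
      rewrite (eq_bigr (fun i => nu (w t) i *: (w (sg i) - w t))).
        under eq_bigr do rewrite scalerBr.
        by rewrite sumrB wE -scaler_suml polar_bary_sum scale1r subrr.
      by move=> i _; rewrite (edges_sum w t) scaler_sumr.
    move=> r _; rewrite mxE scaler_suml big_mkcond; apply: eq_bigr => i _.
    by case: ifP => _; rewrite ?scale1r ?scale0r ?scaler0.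
  have nusg i : nu (w t) i != 0 -> sg i = t.
    move=> nui; apply/eqP; apply: contraT => st.
    have [r sE] : exists r, sg i = lift t r.
      by case: (unliftP t (sg i)) st => [r ->|->]; [exists r|rewrite eqxx].
    move/rowP/(_ r): cE; rewrite !mxE => /eqP; rewrite psumr_eq0 // => /allP H.
    by have := H i (mem_index_enum i); rewrite sE eqxx (negPf nui).
  have [i nui] : exists i, nu (w t) i != 0.
    apply/existsP; apply: contraT => /existsPn H.
    have := polar_bary_sum (w t); rewrite big1 => [/eqP|i _].
      by rewrite eq_sym oner_eq0.
    by have := H i; rewrite negbK => /eqP.
  exists i; rewrite -sgE ?nusg //; exact: (nuI _ _ (Fwt t)).
by exists tau => // t s E; apply: winj; rewrite !tauE E.
Qed.

Hypothesis vint : forall i, integral (v i).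

(** Rationality of the polar vertices ensures that a lattice basis of a face spans all its edges. *)
Lemma polar_vertex_den : exists2 M : R, M != 0 & forall i, integral (M *: p i).
Proof.
have [N [N0 Nb Nq]] := frame_den Sfr vint.
exists (\prod_i (N%:R * beta i)).
  by apply/prodf_neq0 => i _; rewrite mulf_neq0 ?pnatr_eq0 -?lt0n // gt_eqF.
move=> i; rewrite (bigD1 i) //= mulrC -scalerA; apply: integral_ptZ.
  by apply: (big_ind (@intR R)) => //; [exact: (intR_nat _ 1)|exact: intRM].
rewrite /p scalerA.
have -> : N%:R * beta i * - (beta i)^-1 = - N%:R.
  by have := beta_gt0 i => b0; field; rewrite gt_eqF.
by rewrite scaleNr; apply: integral_ptN.
Qed.


(** Writing the edges as [C B] with [B] a lattice basis, [l! vol] is [|det C|]. Pairing the edges at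
    [t] with the vertices [v (tau (lift t i))] gives a diagonal matrix with entries [- 1/beta], as
    the constants 1 in [dot_polar_vertex] cancel. The base [t] stays free so that the weight to be
    dropped can be chosen later. *)
Lemma face_volume F l val : is_face (polar S) F -> has_dim F l -> volZ l F val ->
  exists (tau : 'I_l.+1 -> 'I_d.+1) (B : 'M[R]_(l, d)),
    [/\ injective tau, forall i, integral (row i B),
        (B <= edges (fun t => p (tau t)) ord0)%MS &
        forall t, `|\det (B *m (\matrix_i v (tau (lift t i)))^T)| * (l`!%:R * val) =
                  \prod_i (beta (tau (lift t i)))^-1].
Proof.
move=> Fface [D [Dfree [DF _]]] [w [k [B [Fw [[Bfree [Bint [BF Bgen]]] /= valE]]]]].
have linW y : lin (diffs F) y -> (y <= edges w ord0)%MS.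
  move=> [n [c [r [rF ->]]]]; apply: summx_sub => i _; apply: scalemx_sub.
  by have [a [b [/Fw Fa [/Fw Fb ->]]]] := rF i; apply: conv_sub_edges.
have Wfree : row_free (edges w ord0).
  rewrite /row_free eqn_leq rank_leq_row.
  have /eqP DE := Dfree; rewrite -{1}DE mxrankS //.
  by apply/row_subP => i; apply: linW.
have [tau tinj wE] := face_vertices Fface Fw Wfree.
have [M M0 Mp] := polar_vertex_den.
have Fwt t : F (w t).
  apply/Fw/conv_finP; exists (fun s => (s == t)%:R); split=> [s||].
  - by rewrite ler0n.
  - by rewrite (bigD1 t) //= eqxx big1 ?addr0 // => s /negPf ->.
  - rewrite (bigD1 t) //= eqxx scale1r big1 ?addr0 // => s /negPf ->.
    by rewrite scale0r.
have WB : (edges w ord0 <= B)%MS.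
  apply/row_subP => i; rewrite rowK.
  have [c cE] : exists c : 'rV[int]_k, M *: (w (lift ord0 i) - w ord0) =
      map_mx (fun a : int => a%:~R) c *m B.
    apply: Bgen.
      rewrite scalerBr !wE; apply: integral_ptD => //; exact: integral_ptN.
    exists 1%N, (fun=> M), (fun=> w (lift ord0 i) - w ord0); split.
      by move=> _; exists (w (lift ord0 i)), (w ord0).
    by rewrite big_ord_recl big_ord0 addr0.
  rewrite -[_ - _]scale1r -(mulVf M0) -scalerA cE; apply: scalemx_sub.
  exact: submxMl.
have BW : (B <= edges w ord0)%MS by apply/row_subP => i; apply: linW.
have kl : k = l.
  have rB : \rank B = k by apply/eqP.
  have rW : \rank (edges w ord0) = l by apply/eqP.
  have := mxrankS BW; have := mxrankS WB; rewrite rB rW; lia.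
subst k; exists tau, B.
have wE' : edges (fun t => p (tau t)) ord0 = edges w ord0.
  by apply/row_matrixP => i; rewrite !rowK !wE.
split=> //; first by rewrite wE'.
have [C CE] := submxP WB.
have g0 : 0 < Num.sqrt (\det (B *m B^T)) by rewrite sqrtr_gt0 gram_det_gt0.
have vE : l`!%:R * val = `|\det C|.
  rewrite valE -/(edges w ord0) CE sqrt_gram_mul.
  have : l`!%:R != 0 :> R by rewrite pnatr_eq0 -lt0n fact_gt0.
  move: (Num.sqrt _) g0 => s s0 f0; field.
  by rewrite f0 gt_eqF.
move=> t; rewrite vE.
have -> : \prod_i (beta (tau (lift t i)))^-1 =
    `|\det (edges w t *m (\matrix_i v (tau (lift t i)))^T)|.
  have -> : edges w t *m (\matrix_i v (tau (lift t i)))^T =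
      diag_mx (\row_i - (beta (tau (lift t i)))^-1).
    apply/matrixP => i j; rewrite mulmx_tr_dot !rowK dotC dotBr !wE !dot_polar_vertex.
    rewrite !(inj_eq tinj) (inj_eq (@lift_inj _ t)) (negPf (neq_lift _ _)) !mxE.
    by case: eqVneq => [->|_]; rewrite ?mulr1n ?mulr0n /=; ring.
  rewrite det_diag normr_prod; apply: eq_bigr => i _.
  by rewrite mxE normrN ger0_norm // invr_ge0 ltW.
rewrite (edges_base_change w t ord0) CE -!mulmxA !det_mulmx !normrM.
rewrite (det_base_change ord0 (edges_free t Wfree)) mul1r mulrC //.
Qed.

End PolarFaces.

(** * Dual bases and the faces attaining the bound *)

Section UnimodularFrame.
Variables (R : rcfType) (d : nat) (S : 'rV[R]_d -> Prop).
Variables (v q : 'I_d.+1 -> 'rV[R]_d) (beta : 'I_d.+1 -> R).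
Hypothesis Sfr : frame S v q beta.
Hypothesis beta_gt0 : forall i, 0 < beta i.

(* The basis dual to the vertices other than the last one. *)
Definition dual_basis i := q i - (beta i / beta ord_max) *: q ord_max.
Local Notation b := dual_basis.

Lemma dual_basis_dot i j : j != ord_max -> dot (b i) (v j) = (i == j)%:R.
Proof.
move=> jm; rewrite dotBl dotZl !(frame_dot Sfr) [ord_max == j]eq_sym (negPf jm).
by have b0 := beta_gt0 ord_max; case: (i == j) => /=; field; rewrite gt_eqF.
Qed.

Lemma dual_basis_max : b ord_max = 0.
Proof. by rewrite /b divff ?gt_eqF // scale1r subrr. Qed.

Lemma dual_basis_decomp y : \sum_i dot (v i) y *: b i = y.
Proof.
rewrite /b; under eq_bigr do rewrite scalerBr scalerA mulrA.
rewrite sumrB (frame_dual_decomp Sfr) -scaler_suml -mulr_suml.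
under [X in (X / _)]eq_bigr do rewrite mulrC -dotZl.
by rewrite -dot_suml (frame_origin Sfr) dotC dot0r mul0r scale0r subr0.
Qed.

Lemma dual_basis_edge i : b i = beta i *: (polar_vertex q beta ord_max - polar_vertex q beta i).
Proof.
rewrite /polar_vertex scalerBr !scalerA !mulrN mulfV ?gt_eqF // !scaleNr scale1r.
by rewrite opprK addrC.
Qed.

Lemma dual_basis_sum : \sum_i b i = - (beta ord_max)^-1 *: q ord_max.
Proof.
rewrite sumrB (frame_sum_q Sfr) -scaler_suml -mulr_suml (frame_sum_beta Sfr).
by rewrite sub0r mul1r scaleNr.
Qed.

(** Since [x] is the sum of the [dot (b i) x *: v i], an integral dual basis means that every
    lattice point is an integral combination of the vertices other than the last: lattice index 1,
    without a determinant. *)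
Definition unimodular := forall i, i != ord_max -> integral (b i).

Section ExtremalFace.
Variable l : nat.
Hypothesis ld : (1 <= l <= d)%N.
Hypothesis vint : forall i, i != ord_max -> integral (v i).
Hypothesis uni : unimodular.
Local Notation p := (polar_vertex q beta).
Local Notation a := (d - l)%N.

Let jj (i : 'I_l) : 'I_d.+1 := inord (a + i).
(** Position 0, the base vertex in [volZ], goes to [ord_max], because the dual basis vectors are
    multiples of the edges at [p ord_max]. *)
Let idx (t : 'I_l.+1) : 'I_d.+1 := if unlift ord0 t is Some i then jj i else ord_max.
Let w t := p (idx t).

Let jjE i : (jj i : nat) = (a + i)%N.
Proof. by rewrite inordK //; have := ltn_ord i; lia. Qed.

Let jj_max i : jj i != ord_max.
Proof. by rewrite -val_eqE /= jjE; have := ltn_ord i; lia. Qed.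

Let jj_eq i k : (jj i == jj k) = (i == k).
Proof. by rewrite -!val_eqE /= !jjE eqn_add2l. Qed.

Let idx0 : idx ord0 = ord_max. Proof. by rewrite /idx unlift_none. Qed.
Let idxS i : idx (lift ord0 i) = jj i. Proof. by rewrite /idx liftK. Qed.

Let idx_ge t : (a <= idx t)%N.
Proof.
case: (unliftP ord0 t) => [i ->|->]; last by rewrite idx0 leq_subr.
by rewrite idxS jjE leq_addr.
Qed.

Let sum_jj (V : zmodType) (G : 'I_d.+1 -> V) :
  (forall i : 'I_d.+1, (i < a)%N -> G i = 0) ->
  \sum_i G i = \sum_(i < l) G (jj i) + G ord_max.
Proof.
move=> G0; rewrite big_ord_recr /=; congr (_ + _).
have -> : \sum_(i < d) G (widen_ord (leqnSn d) i) = \sum_(0 <= i < d) G (inord i).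
  rewrite big_mkord; apply: eq_bigr => i _; congr G; apply/val_inj.
  by rewrite /= inordK // (leq_trans (ltn_ord i)).
rewrite (big_cat_nat _ (n := a)) ?leq_subr //= big_nat big1 => [|i /andP[_ ia]].
  rewrite add0r -{1}[a]add0n big_addn big_mkord subKn; last by case/andP: ld.
  by apply: eq_bigr => i _; rewrite addnC.
by apply: G0; rewrite inordK //; lia.
Qed.

Definition extremal_face y := polar S y /\ forall j : 'I_d.+1, (j < a)%N -> dot (v j) y = 1.
Local Notation F := extremal_face.

Let Fp t : F (w t).
Proof.
split=> [|j ja]; first exact: (polar_vertex_polar Sfr).
rewrite (dot_polar_vertex Sfr) //; case: eqVneq => [E|_]; last by rewrite mul0r subr0.
by have := idx_ge t; rewrite E leqNgt ja.
Qed.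

Let F_face : is_face (polar S) F.
Proof.
exists (\sum_(j : 'I_d.+1 | (j < a)%N) v j), (\sum_(j : 'I_d.+1 | (j < a)%N) 1); split.
  by move=> y /(polarP Sfr) yS; rewrite dot_suml; apply: ler_sum.
move=> y; rewrite dot_suml; split=> -[yS yv]; split=> //; first exact: eq_bigr.
move=> j ja; have /eqP : \sum_(j : 'I_d.+1 | (j < a)%N) (1 - dot (v j) y) = 0.
  by rewrite sumrB yv subrr.
rewrite psumr_eq0 => [/allP/(_ j (mem_index_enum j))|i _].
  by rewrite ja subr_eq0 eq_sym => /eqP.
by rewrite subr_ge0; have /(polarP Sfr) := yS; apply.
Qed.

Let F_conv x : F x <-> conv (fun y => exists i, y = w i) x.
Proof.
rewrite conv_finP; split=> [[xS xv]|[c [c0 c1 ->]]].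
  exists (fun t => polar_bary v beta x (idx t)).
  have nu0 (i : 'I_d.+1) : (i < a)%N -> polar_bary v beta x i = 0.
    by move=> ia; rewrite /polar_bary xv // subrr mulr0.
  split.
  - by move=> t; apply: (polar_bary_ge0 Sfr).
  - rewrite big_ord_recl idx0 addrC -(polar_bary_sum Sfr x) sum_jj //.
    by congr (_ + _); apply: eq_bigr => i _; rewrite idxS.
  - rewrite big_ord_recl /w idx0 addrC -[LHS](polar_bary_decomp Sfr beta_gt0) sum_jj.
      by congr (_ + _); apply: eq_bigr => i _; rewrite idxS.
    by move=> i ia; rewrite nu0 // scale0r.
split=> [|j ja].
  apply/(polarP Sfr) => j; rewrite dot_sumr -c1; apply: ler_sum => t _.
  rewrite dotZr -[X in _ <= X]mulr1 ler_wpM2l //.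
  by have [/(polarP Sfr)] := Fp t.
rewrite dot_sumr -[RHS]c1; apply: eq_bigr => t _; rewrite dotZr.
by have [_ ->] := Fp t; rewrite ?mulr1.
Qed.

Let B : 'M[R]_(l, d) := \matrix_i b (jj i).

Let B_free : row_free B.
Proof.
apply/row_freeP; exists (\matrix_i v (jj i))^T; apply/matrixP => i k.
by rewrite mulmx_tr_dot !rowK dual_basis_dot // jj_eq !mxE.
Qed.

Let B_lin i : lin (diffs F) (row i B).
Proof.
exists 1%N, (fun=> beta (jj i)), (fun=> w ord0 - w (lift ord0 i)); split.
  by move=> _; exists (w ord0), (w (lift ord0 i)).
by rewrite big_ord_recl big_ord0 addr0 rowK dual_basis_edge /w idx0 idxS.
Qed.

Let diffs_dot y : diffs F y -> forall j : 'I_d.+1, (j < a)%N -> dot (v j) y = 0.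
Proof.
by move=> [x [x' [[_ xF] [[_ xF'] ->]]]] j ja; rewrite dotBr xF // xF' // subrr.
Qed.

Let B_decomp y : (forall j : 'I_d.+1, (j < a)%N -> dot (v j) y = 0) ->
  y = (\row_i dot (v (jj i)) y) *m B.
Proof.
move=> y0; rewrite -[LHS]dual_basis_decomp sum_jj => [|i /y0 ->]; last by rewrite scale0r.
rewrite dual_basis_max scaler0 addr0 mulmx_sum_row; apply: eq_bigr => i _.
by rewrite rowK mxE.
Qed.

(** The [b (jj i)] form a lattice basis of the face: the coefficients of a lattice vector are its
    integral pairings with the [v (jj i)]. The edges at [p ord_max] are these vectors divided by
    [- beta]. *)
Lemma extremal_face_volume :
  exists F', [/\ is_face (polar S) F', has_dim F' l
    & volZ l F' ((\prod_(a <= i < d) beta (inord i))^-1 / l`!%:R)].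
Proof.
exists F; split; first exact: F_face.
  exists B; split=> //; split=> [i|y /diffs_dot/B_decomp ->]; first exact: B_lin.
  exact: submxMl.
exists w, l, B; split; first exact: F_conv.
split.
  split=> //; split=> [i|]; first by rewrite rowK; apply: uni.
  split=> // z zint [n [c [r [rF zE]]]].
  have zv j : j != ord_max -> intR (dot (v j) z) by move=> /vint vj; apply: intR_dot.
  have /B_decomp zB : forall j : 'I_d.+1, (j < a)%N -> dot (v j) z = 0.
    move=> j ja; rewrite zE dot_sumr big1 // => i _.
    by rewrite dotZr (diffs_dot (rF i)) ?mulr0.
  have [c' cE] : exists Z : 'rV[int]_l, \row_i dot (v (jj i)) z = map_mx intr Z.
    by apply: intR_mx => i j; rewrite mxE; apply: zv.
  by exists c'; rewrite zB cE.
move=> W; pose C : 'M[R]_l := diag_mx (\row_i - (beta (jj i))^-1).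
have -> : W = C *m B.
  apply/row_matrixP => i; rewrite row_mul row_diag_mx -scalemxAl -rowE !rowK mxE.
  rewrite dual_basis_edge scalerA mulNr mulVf ?gt_eqF // scaleN1r opprB.
  by rewrite /w idx0 idxS.
rewrite sqrt_gram_mul.
have -> : `|\det C| = (\prod_(a <= i < d) beta (inord i))^-1.
  rewrite det_diag normr_prod -prodfV -{1}[a]add0n big_addn big_mkord subKn; last by case/andP: ld.
  apply: eq_bigr => i _; rewrite mxE normrN ger0_norm ?invr_ge0 ?ltW //.
  by rewrite addnC.
have g0 : 0 < Num.sqrt (\det (B *m B^T)) by rewrite sqrtr_gt0 gram_det_gt0.
have f0 : l`!%:R != 0 :> R by rewrite pnatr_eq0 -lt0n fact_gt0.
move: (Num.sqrt _) g0 (_^-1) => s s0 P; field.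
by rewrite f0 gt_eqF.
Qed.

End ExtremalFace.
End UnimodularFrame.

(** * The extremal simplex *)

Section ExtremalSimplex.
Variables (R : rcfType) (d : nat).
Hypothesis d_gt0 : (0 < d)%N.
Local Notation pt := 'rV[R]_d.
Local Notation Sext := (polar (translate (@S1 R d) (@e_all R d))).
Local Notation ew i := (ext_weight R d i).
Local Notation e := (@e_all R d).

Lemma ext_weight_gt0 i : 0 < ew i.
Proof.
rewrite /ext_weight; case: ifP => _; first exact: sylv_inv_gt0.
by rewrite invr_gt0 ltr0n muln_gt0 sylv_prod_gt0.
Qed.

Lemma ext_weight_prod a : (a < d)%N ->
  \prod_(a <= i < d) ew i = (sylv_prod a)%:R / (2 * sylv_prod d.-1 ^ 2)%:R.
Proof.
move=> ad; have dE : d = d.-1.+1 by lia.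
rewrite {1}dE big_nat_recr /=; last lia.
rewrite {2}/ext_weight ltnn (eq_big_nat _ _ (F2 := sylv_inv R)) => [|i /andP[_ id]].
  rewrite prod_sylv_inv; last lia.
  by rewrite !natrM; field; rewrite gt_eqF ?sylv_prodR_gt0.
by rewrite /ext_weight id.
Qed.

Lemma ext_weight_sum : \sum_(i < d.+1) ew i = 1.
Proof.
have dE : d = d.-1.+1 by lia.
rewrite -(big_mkord xpredT (fun i => ew i)) big_nat_recr //= {1}dE big_nat_recr //=.
rewrite (eq_big_nat _ _ (F2 := sylv_inv R)) => [|i /andP[_ id]]; last by rewrite /ext_weight id.
rewrite sum_sylv_inv /ext_weight ltnn ifN; last lia.
by rewrite natrM; field; rewrite gt_eqF ?sylv_prodR_gt0.
Qed.

Lemma dot_e_all (x : pt) : dot e x = \sum_i x 0 i.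
Proof. by apply: eq_bigr => i _; rewrite mxE mul1r. Qed.

Lemma lift_max_val (j : 'I_d) : (lift ord_max j : nat) = j.
Proof. by rewrite /= /bump leqNgt ltn_ord. Qed.

Lemma S1_coefE (j : 'I_d) : S1_coef R j = (ew j)^-1.
Proof.
rewrite /S1_coef /ext_weight.
have -> : (j.+1 < d)%N = (j < d.-1)%N by apply/idP/idP; lia.
case: ifP => _; rewrite invrK; first by rewrite /sylv /=.
by congr _%:R; rewrite /sylv addnK.
Qed.

(** Each vertex [w] of the shifted [S1] bounds its polar by [dot w y <= 1]. As [S1_coef j] is the
    inverse of the [j]-th weight, the slack times the weight is a barycentric coordinate, which
    yields [ext_q]. The dual family is [ext_v]: negated unit vectors and one vertex balancing
    them. *)
Definition ext_v (i : 'I_d.+1) : pt :=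
  if unlift ord_max i is Some j then - delta_mx 0 j else \row_j (ew j / ew d).
Definition ext_q (i : 'I_d.+1) : pt :=
  if unlift ord_max i is Some j then ew j *: e - delta_mx 0 j else ew d *: e.

Lemma ext_frame : frame Sext ext_v ext_q (fun i => ew i).
Proof.
have sumw : \sum_(j < d) ew j = 1 - ew d.
  by rewrite -ext_weight_sum big_ord_recr /= addrK.
have e0 := ext_weight_gt0 d.
have sumr : \sum_(j < d) ew j / ew d = (1 - ew d) / ew d by rewrite -mulr_suml sumw.
split=> [i j|y].
  rewrite /ext_q /ext_v; case: (unliftP ord_max i) => [i' ->|->];
    case: (unliftP ord_max j) => [j' ->|->].
  - rewrite (inj_eq (@lift_inj _ ord_max)) lift_max_val dotNr dot_delta !mxE.
    by rewrite !eqxx /= eq_sym; ring.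
  - rewrite dotBl dotZl dot_e_all [dot (delta_mx _ _) _]dotC dot_delta.
    rewrite (eq_bigr (fun j : 'I_d => ew j / ew d)) => [|k _]; last by rewrite mxE.
    rewrite sumr mxE lift_max_val eq_sym (negPf (neq_lift _ _)) /=.
    by field; rewrite gt_eqF.
  - by rewrite dotNr dot_delta !mxE mulr1 /= (negPf (neq_lift _ _)) addrC subrr.
  - rewrite dotZl dot_e_all eqxx /=.
    rewrite (eq_bigr (fun j : 'I_d => ew j / ew d)) => [|k _]; last by rewrite mxE.
    by rewrite sumr; field; rewrite gt_eqF.
have q_max : 0 <= ew d + ew d * dot e y <-> dot (0 - e) y <= 1.
  by rewrite dotBl [dot 0 y]dotC dot0r; split=> H; nra.
have q_lift (j : 'I_d) : 0 <= ew j + (ew j * dot e y - y 0 j) <->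
    dot (S1_coef R j *: delta_mx 0 j - e) y <= 1.
  have j0 := ext_weight_gt0 j.
  rewrite dotBl dotZl [dot (delta_mx _ _) _]dotC dot_delta S1_coefE.
  have jE : y 0 j = ew j * ((ew j)^-1 * y 0 j) by rewrite mulrA mulfV ?mul1r ?gt_eqF.
  by rewrite {1}jE; move: (_^-1 * _) => t; split=> H; nra.
split=> [H i|H z [n [lam [r [rA [l0 [l1 zE]]]]]]].
  rewrite /ext_q; case: (unliftP ord_max i) => [j ->|->].
    rewrite dotBl dotZl [dot (delta_mx _ _) _]dotC dot_delta lift_max_val.
    apply/q_lift/H; exists 1%N, (fun=> 1), (fun=> S1_coef R j *: delta_mx 0 j).
    split; first by move=> _; right; exists j.
    by rewrite !big_ord_recl !big_ord0 !addr0 scale1r subrK.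
  rewrite dotZl; apply/q_max/H; exists 1%N, (fun=> 1), (fun=> 0).
  split; first by left.
  by rewrite !big_ord_recl !big_ord0 !addr0 scale1r subrK.
have -> : z = \sum_i lam i *: (r i - e).
  under eq_bigr do rewrite scalerBr.
  by rewrite sumrB -zE -scaler_suml l1 scale1r addrK.
rewrite dot_suml -l1; apply: ler_sum => i _.
rewrite dotZl -[X in _ <= X]mulr1 ler_wpM2l //.
have [->|[j ->]] := rA i.
  by apply/q_max; have := H ord_max; rewrite /ext_q unlift_none dotZl.
apply/q_lift; have := H (lift ord_max j).
by rewrite /ext_q liftK dotBl dotZl [dot (delta_mx _ _) _]dotC dot_delta lift_max_val.
Qed.

Lemma ext_dual_basis (j : 'I_d) :
  dual_basis ext_q (fun i => ew i) (lift ord_max j) = - delta_mx 0 j.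
Proof.
rewrite /dual_basis /ext_q liftK unlift_none scalerA lift_max_val.
by rewrite divfK ?gt_eqF ?ext_weight_gt0 // addrC addKr.
Qed.

Section Equivalence.
Variable S : pt -> Prop.

(** The linear map sending the first [d] vertices to the [- e_j] is given by the dual basis and its
    inverse by the vertices, both integral. Equal weights make it match the whole frames. *)
Lemma unimod_equiv_ext (v q : 'I_d.+1 -> pt) :
  frame S v q (fun i => ew i) -> (forall i, i != ord_max -> integral (v i)) ->
  unimodular q (fun i => ew i) -> unimod_equiv S Sext.
Proof.
move=> Sfr vint uni.
have ew0 (i : 'I_d.+1) : 0 < ew i by apply: ext_weight_gt0.
pose b := dual_basis q (fun i => ew i).
have lm (i : 'I_d) : lift ord_max i != ord_max by rewrite eq_sym neq_lift.
pose Bm := \matrix_(i < d) b (lift ord_max i).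
pose V := \matrix_(i < d) v (lift ord_max i).
have VB : V *m Bm^T = 1%:M.
  apply/matrixP => i j; rewrite mulmx_tr_dot !rowK dotC (dual_basis_dot Sfr) //.
  by rewrite (inj_eq (@lift_inj _ ord_max)) eq_sym mxE.
pose M := - Bm^T.
have VM : (- V) *m M = 1%:M by rewrite mulNmx mulmxN opprK.
have MV := mulmx1C VM.
have xM x i : (x *m M) 0 i = - dot x (b (lift ord_max i)).
  by rewrite mulmxN mxE mulmx_tr_dot rowK row_id.
have MT : M^T = - Bm by rewrite linearN /= trmxK.
have qM i : ext_q i *m M^T = q i.
  have eB : e *m Bm = - (ew d)^-1 *: q ord_max.
    have := dual_basis_sum Sfr; rewrite big_ord_recr /= (dual_basis_max _ ew0) addr0 => <-.
    rewrite mulmx_sum_row; apply: eq_bigr => j _; rewrite mxE scale1r rowK.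
    by congr dual_basis; apply/val_inj; rewrite /= /bump leqNgt ltn_ord.
  rewrite MT mulmxN /ext_q; case: (unliftP ord_max i) => [j ->|->].
    rewrite mulmxBl -rowE rowK -scalemxAl eB /b /dual_basis lift_max_val.
    by rewrite scalerA mulrN scaleNr opprB opprK subrK.
  by rewrite -scalemxAl eB scalerA mulrN mulfV ?gt_eqF ?ext_weight_gt0 // scaleN1r opprK.
have qd x i : dot (ext_q i) (x *m M) = dot (q i) x by rewrite dotC dot_mulmx qM dotC.
have SM x : S x <-> Sext (x *m M).
  by rewrite Sfr.2 ext_frame.2; split=> H i; have := H i; rewrite qd.
exists M, 0; split; last split.
- by case/mulmx1_unit: VM.
- move=> x; rewrite addr0; split=> xint.
    apply/integralP => i; rewrite xM; apply/intRN/intR_dot => //; exact: uni.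
  rewrite -[x]mulmx1 -MV mulmxA mulmxN; apply: integral_ptN.
  rewrite mulmx_sum_row; apply: integral_pt_sum => i _; apply: integral_ptZ.
    by move/integralP: xint; apply.
  by rewrite rowK; apply: vint.
- move=> y; split=> [yS|[x [/SM xS ->]]]; last by rewrite addr0.
  exists (y *m - V); rewrite addr0 -mulmxA VM mulmx1; split=> //.
  by apply/SM; rewrite -mulmxA VM mulmx1.
Qed.

(** The frame of the extremal simplex is pulled back. The preimage of the origin is an interior
    lattice point of [S], hence 0, so the equivalence has no translation part. *)
Lemma frame_of_unimod_equiv (v q : 'I_d.+1 -> pt) (beta : 'I_d.+1 -> R) :
  frame S v q beta ->
  (forall x, integral x -> (forall i, 0 < beta i + dot (q i) x) -> x = 0) ->
  unimod_equiv S Sext ->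
  exists v' q', [/\ frame S v' q' (fun i => ew i),
    forall i, i != ord_max -> integral (v' i) & unimodular q' (fun i => ew i)].
Proof.
move=> Sfr uniq [M [t [MU [Mint MS]]]].
have Minj x y : x *m M = y *m M -> x = y.
  by move=> /(congr1 (mulmx^~ (invmx M))); rewrite !mulmxK.
have SM x : S x <-> Sext (x *m M + t).
  rewrite MS; split=> [xS|[x' [x'S /addIr/Minj ->]]] //; by exists x.
have t0 : t = 0.
  pose x0 := - t *m invmx M.
  have x0t : x0 *m M + t = 0 by rewrite mulmxKV // addNr.
  have x00 : x0 = 0.
    apply: uniq; first by apply/Mint; rewrite x0t; apply: integral_pt0.
    apply: (frame_algebraic_interior Sfr) => // z.
    pose s := 1 + \sum_i `|dot (ext_q i) (z *m M)| / ew i.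
    have s0 : 0 < s.
      rewrite ltr_pwDl // sumr_ge0 // => i _; rewrite divr_ge0 // ltW //.
      exact: ext_weight_gt0.
    exists s^-1; rewrite ?invr_gt0 //; apply/SM.
    rewrite mulmxDl addrAC x0t add0r; apply/ext_frame.2 => i.
    rewrite -scalemxAl dotZr; have i0 := ext_weight_gt0 i.
    have : `|dot (ext_q i) (z *m M)| / ew i <= s.
      rewrite /s (bigD1 i) //= addrCA lerDl addr_ge0 // sumr_ge0 // => j _.
      by rewrite divr_ge0 // ltW // ext_weight_gt0.
    rewrite ler_pdivrMr // ler_norml => /andP[H _].
    rewrite -(ler_pM2l s0) mulr0 mulrDr mulrA mulfV ?gt_eqF // mul1r; lra.
  by move: x0t; rewrite x00 mul0mx add0r.
subst t.
have {}Mint x : integral x <-> integral (x *m M) by rewrite Mint addr0.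
have {}SM x : S x <-> Sext (x *m M) by rewrite SM addr0.
exists (fun i => ext_v i *m invmx M), (fun i => ext_q i *m M^T); split.
- split=> [i j|x]; last first.
    rewrite SM ext_frame.2; split=> H i; have := H i; by rewrite dot_mulmx trmxK.
  by rewrite dot_mulmx trmxK mulmxKV // ext_frame.1.
- move=> i im; apply/Mint; rewrite mulmxKV //.
  case: (unliftP ord_max i) im => [j ->|->]; last by rewrite eqxx.
  by rewrite /ext_v liftK => _; apply/integral_ptN/integral_delta.
- move=> i im; case: (unliftP ord_max i) im => [j -> _|->]; last by rewrite eqxx.
  have -> : dual_basis (fun i => ext_q i *m M^T) (fun i => ew i) (lift ord_max j) =
      dual_basis ext_q (fun i => ew i) (lift ord_max j) *m M^T.
    by rewrite /dual_basis mulmxBl scalemxAl.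
  rewrite ext_dual_basis mulNmx; apply/integral_ptN/integralP => k.
  rewrite -rowE !mxE.
  have /Mint/integralP/(_ j) := @integral_delta R d k.
  by rewrite -rowE mxE.
Qed.

End Equivalence.
End ExtremalSimplex.

(** * Canonical simplices *)

Lemma big_nat_inord (T : Type) (idx : T) (op : Monoid.com_law idx) d a
    (G : 'I_d.+1 -> T) :
  \big[op/idx]_(a <= i < d) G (inord i) = \big[op/idx]_(i : 'I_d.+1 | (a <= i < d)%N) G i.
Proof.
rewrite (@big_nat_widen _ _ _ a d d.+1) // big_geq_mkord.
by apply: eq_big => [i|i _]; rewrite ?inord_val //= andbC.
Qed.

Section CanonicalSimplex.
Variables (R : rcfType) (d : nat) (S : 'rV[R]_d -> Prop).

Lemma canonical_frame : (0 < d)%N -> in_Sd1 S -> interior S 0 ->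
  exists v q beta, [/\ forall i, integral (v i), frame S v q beta,
    forall i j : 'I_d.+1, (i <= j)%N -> beta j <= beta i,
    forall i, 0 < beta i &
    forall x, integral x -> (forall i, 0 < beta i + dot (q i) x) -> x = 0].
Proof.
move=> d0 [/sorted_frame_exists[v [q [beta [vint Sfr bs]]]] [x0 [_ x0u]]] S0.
exists v, q, beta; split=> // [i|x xint xpos].
  have := frame_algebraic_interior Sfr d0 (interior_algebraic S0) i.
  by rewrite dot0r addr0.
have -> := x0u x xint (frame_interior Sfr xpos).
by rewrite -(x0u 0 (integral_pt0 R d) S0).
Qed.

Variables (v q : 'I_d.+1 -> 'rV[R]_d) (beta : 'I_d.+1 -> R).
Hypothesis vint : forall i, integral (v i).
Hypothesis Sfr : frame S v q beta.
Hypothesis beta_gt0 : forall i, 0 < beta i.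

(** Used for [l = d]: two integral matrices whose product has determinant 1 in absolute value are
    both unimodular, and the dual basis consists of the columns of the inverse of [V]. *)
Lemma unimodular_of_det (tau : 'I_d.+1 -> 'I_d.+1) (t : 'I_d.+1) (B : 'M[R]_d) :
  injective tau -> (forall i, (tau (lift t i) < tau t)%N) ->
  (forall i, integral (row i B)) ->
  `|\det (B *m (\matrix_i v (tau (lift t i)))^T)| = 1 ->
  unimodular q beta.
Proof.
move=> tinj tlt Bint; set V := \matrix_i _; rewrite det_mulmx det_tr normrM => BV.
have tmax : tau t = ord_max.
  have [t' t'E] : exists t', tau t' = ord_max.
    by have [g _ gK] := injF_bij tinj; exists (g ord_max); apply: gK.
  case: (unliftP t t') t'E => [j ->|->] // E.
  by have := tlt j; rewrite E /=; have := leq_ord (tau t); lia.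
have [Z ZE] : exists Z : 'M[int]_d, V = map_mx intr Z.
  by apply: intR_mx => i j; rewrite mxE; have /integralP := vint (tau (lift t i)); apply.
have detV : `|\det V| = 1.
  have [zB zBE] : intR (\det B).
    by apply: intR_det => i j; have /integralP/(_ j) := Bint i; rewrite mxE.
  have B0 : \det B != 0.
    by apply: contra_eq_neq BV => ->; rewrite normr0 mul0r eq_sym oner_neq0.
  have V0 : \det V != 0.
    by apply: contra_eq_neq BV => ->; rewrite normr0 mulr0 eq_sym oner_neq0.
  have := intR_norm_ge1 (ex_intro _ zB zBE) B0.
  have iV : intR (\det V) by exists (\det Z); rewrite ZE det_map_mx.
  have := intR_norm_ge1 iV V0; move: (`|\det B|) (`|\det V|) BV => x y; nra.
have detV2 : \det V * \det V = 1.
  by rewrite -expr2 -real_normK ?num_real // detV expr1n.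
move=> j jm; have [i jE] : exists i, j = tau (lift t i).
  have [g _ gK] := injF_bij tinj; rewrite -(gK j).
  case: (unliftP t (g j)) => [i ->|E]; first by exists i.
  by move: jm; rewrite -(gK j) E tmax eqxx.
pose b := dual_basis q beta j.
have Vb : V *m b^T = delta_mx i 0.
  apply/matrixP => k k'; rewrite ord1 mulmx_tr_dot rowK row_id dotC.
  rewrite (dual_basis_dot Sfr) //; last first.
    by rewrite -tmax (inj_eq tinj) eq_sym neq_lift.
  by rewrite jE (inj_eq tinj) (inj_eq (@lift_inj _ t)) !mxE eqxx andbT eq_sym.
have bE : \det V *: b^T = col i (\adj V).
  have := mul_adj_mx V => /(congr1 (mulmx^~ b^T)).
  by rewrite -mulmxA Vb -colE mul_scalar_mx => ->.
rewrite -/b -[b]scale1r -detV2 -scalerA; apply: integral_ptZ.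
  by exists (\det Z); rewrite ZE det_map_mx.
apply/integralP => k; have /matrixP/(_ k 0) := bE; rewrite !mxE => ->.
have : map_mx intr (\adj Z) = \adj V by rewrite ZE map_mx_adj.
by move=> /matrixP/(_ k i); rewrite !mxE => <-; apply: intR_int.
Qed.

Hypothesis beta_sorted : forall i j : 'I_d.+1, (i <= j)%N -> beta j <= beta i.
Hypothesis int_uniq :
  forall x, integral x -> (forall i, 0 < beta i + dot (q i) x) -> x = 0.
Hypothesis d4 : (4 <= d)%N.
Local Notation u := sylv_prod.
Local Notation ew i := (ext_weight R d i).

Lemma frame_weights a : (a < d)%N ->
  (u a)%:R / (2 * u d.-1 ^ 2)%:R <= \prod_(a <= i < d) beta (inord i) /\
  ((u a)%:R / (2 * u d.-1 ^ 2)%:R = \prod_(a <= i < d) beta (inord i) ->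
   forall i : 'I_d.+1, beta i = ew i).
Proof.
move=> ad.
have [||||le E] := @weights_prod_ge R d (fun i => beta (inord i)) _ _ _ _ a d4 ad.
- by move=> i _.
- by move=> i id; apply: beta_sorted; rewrite !inordK //; lia.
- rewrite big_mkord -(frame_sum_beta Sfr); apply: eq_bigr => i _.
  by rewrite inord_val.
- by move=> k kd; apply: (product_sum Sfr).
split=> // /E H i; by have := H i (leq_ord i); rewrite inord_val.
Qed.

(** Exchange argument: [A] and the block [T] have equally many elements outside each other, and the
    first weight [c] of the block separates the two differences. *)
Lemma tail_prod_le (A : {set 'I_d.+1}) : (0 < #|A| <= d)%N -> ord_max \notin A ->
  \prod_(d - #|A| <= i < d) beta (inord i) <= \prod_(i in A) beta i.
Proof.
move=> A0 Amax; set a := (d - #|A|)%N.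
pose T := [set i : 'I_d.+1 | (a <= i < d)%N].
have TE : \prod_(a <= i < d) beta (inord i) = \prod_(i in T) beta i.
  by rewrite big_nat_inord; apply: eq_bigl => i; rewrite inE.
have cT : #|T| = #|A|.
  rewrite -sum1_card (eq_bigl (fun i : 'I_d.+1 => (a <= i < d)%N)) => [|i]; last by rewrite inE.
  rewrite -(@big_nat_inord _ _ _ d a (fun=> 1%N)) sum_nat_const_nat muln1 /a.
  lia.
rewrite TE (big_setID A) /= [X in _ <= X](big_setID T) /= setIC.
apply: ler_wpM2l; first by apply: prodr_ge0 => i _; apply: ltW.
have cAT : #|T :\: A| = #|A :\: T|.
  by apply: (@addnI #|T :&: A|); rewrite cardsID cT setIC cardsID.
pose c := beta (inord a).
have aE : (inord a : 'I_d.+1) = a :> nat by rewrite inordK // /a; lia.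
apply: (@le_trans _ _ (c ^+ #|T :\: A|)).
  rewrite -prodr_const; apply: ler_prod => i; rewrite !inE => /andP[_ /andP[ai _]].
  by rewrite ltW //= beta_sorted // aE.
rewrite cAT -prodr_const; apply: ler_prod => i; rewrite !inE => /andP[nT iA].
apply/andP; split; first exact/ltW/beta_gt0.
apply: beta_sorted; rewrite aE.
have im : i != ord_max by apply: contraNneq Amax => <-.
have : (i < d)%N by rewrite -val_eqE /= in im; have := leq_ord i; lia.
lia.
Qed.

Definition vol_bound l : R := (2 * u d.-1 ^ 2)%:R / (l`! * u (d - l))%:R.

Lemma face_bound F l val : (1 <= l <= d)%N ->
  is_face (polar S) F -> has_dim F l -> volZ l F val ->
  val <= vol_bound l /\
  (val = vol_bound l ->
   (forall i : 'I_d.+1, beta i = ew i) /\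
   exists (tau : 'I_l.+1 -> 'I_d.+1) (B : 'M[R]_(l, d)) (t : 'I_l.+1),
     [/\ injective tau, forall i, integral (row i B),
         (B <= edges (fun s => polar_vertex q beta (tau s)) ord0)%MS,
         forall i, (tau (lift t i) < tau t)%N &
         `|\det (B *m (\matrix_i v (tau (lift t i)))^T)| = 1 /\
         \prod_i beta (tau (lift t i)) = (u (d - l))%:R / (2 * u d.-1 ^ 2)%:R]).
Proof.
move=> ld Fface Fdim Fvol.
have [tau [B [tinj Bint Bedge Bvol]]] := face_volume Sfr beta_gt0 vint Fface Fdim Fvol.
(* Basing the face at its vertex of largest index drops the smallest weight and keeps [ord_max] out
   of the remaining set. *)
have [t tmax] : exists t, forall s, (tau s <= tau t)%N.
  case: (@arg_maxnP _ ord0 xpredT (fun t => tau t : nat) isT) => t _ tm.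
  by exists t => s; apply: tm.
have tlt i : (tau (lift t i) < tau t)%N.
  rewrite ltn_neqAle tmax andbT val_eqE (inj_eq tinj).
  by rewrite eq_sym neq_lift.
have {Bvol} := Bvol t.
set z := \det _; set P := \prod_i beta (tau (lift t i)).
have P0 : 0 < P by apply: prodr_gt0.
rewrite prodfV -/P => zval.
have zint : intR z.
  by apply: intR_det => i j; rewrite mulmx_tr_dot rowK; apply: intR_dot.
have z0 : z != 0.
  apply: contraTneq P0 => z0; move: zval; rewrite z0 normr0 mul0r => /esym/eqP.
  by rewrite invr_eq0 => /eqP ->; rewrite ltxx.
have z1 := intR_norm_ge1 zint z0.
have [wle weq] := @frame_weights (d - l)%N ltac:(lia).
set Q := _ / _ in wle weq; set Pt := \prod_(_ <= _ < _) _ in wle weq.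
have u0 := sylv_prodR_gt0 R (d - l).
have u1 : 0 < (2 * u d.-1 ^ 2)%:R :> R.
  by rewrite ltr0n muln_gt0 expn_gt0 sylv_prod_gt0.
have Q0 : 0 < Q by rewrite divr_gt0.
have PtP : Pt <= P.
  pose A := [set tau (lift t i) | i : 'I_l].
  have linj : injective (fun i => tau (lift t i)) by move=> i j /tinj/lift_inj.
  have cA : #|A| = l by rewrite card_imset // card_ord.
  have -> : P = \prod_(i in A) beta i.
    by rewrite big_imset /=; [apply: eq_bigl|move=> i j _ _; apply: linj].
  rewrite /Pt -{1}cA; apply: tail_prod_le; first by rewrite cA.
  apply/imsetP => -[i _ E]; have := tlt i; rewrite -E /=.
  by have := leq_ord (tau t); lia.
have f0 : 0 < l`!%:R :> R by rewrite ltr0n fact_gt0.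
have bE : vol_bound l = Q^-1 / l`!%:R.
  by rewrite /vol_bound /Q invf_div [(l`! * _)%:R]natrM invfM mulrCA mulrC.
have valE : val = (`|z| * P)^-1 / l`!%:R.
  rewrite invfM -zval mulrA mulVf ?mul1r; last by rewrite normr_eq0.
  by rewrite mulrC mulKf // gt_eqF.
have QzP : Q <= `|z| * P.
  by apply: le_trans wle _; apply: le_trans PtP _; rewrite ler_peMl // ltW.
have zP0 : 0 < `|z| * P by apply: lt_le_trans QzP.
rewrite bE valE; split.
  by rewrite ler_wpM2r ?invr_ge0 ?(ltW f0) // lef_pV2.
move=> /(mulIf (invr_neq0 (lt0r_neq0 f0)))/invr_inj E.
have PQ : P = Q.
  apply: le_anti; rewrite (le_trans wle PtP) andbT -E ler_peMl // ltW //.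
split; first by apply: weq; apply: le_anti; rewrite wle -[X in _ <= X]PQ.
exists tau, B, t; split=> //; split=> //.
by apply: (mulIf (lt0r_neq0 P0)); rewrite mul1r E PQ.
Qed.

(* With the extremal weights the product-sum inequality for the first d-1
   vertices is an equality, so those vertices generate all lattice points of the
   hyperplane that they span. *)
Lemma ext_span_int x : (forall i : 'I_d.+1, beta i = ew i) -> integral x ->
  (exists2 mu : 'I_d.+1 -> R, forall i : 'I_d.+1, (d.-1 <= i)%N -> mu i = 0 &
     x = \sum_i mu i *: v i) ->
  exists2 m : 'I_d.+1 -> int, forall i : 'I_d.+1, (d.-1 <= i)%N -> m i = 0 &
     x = \sum_i (m i)%:~R *: v i.
Proof.
move=> bE xint [mu mu0 xE].
pose k := d.-2; have kd : (k.+1 <= d.+1)%N by rewrite /k; lia.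
have kE : k.+1 = d.-1 by rewrite /k; lia.
have narrow (c : 'I_d.+1 -> R) : (forall i : 'I_d.+1, (d.-1 <= i)%N -> c i = 0) ->
    \sum_i c i *: v i = \sum_(i < k.+1) c (widen_ord kd i) *: v (widen_ord kd i).
  move=> c0; rewrite (bigID (fun i : 'I_d.+1 => (i < k.+1)%N)) /= [X in _ + X]big1.
    by rewrite addr0 (big_ord_narrow kd).
  by move=> i; rewrite -leqNgt kE => /c0 ->; rewrite scale0r.
case: (classic (exists m : 'I_k.+1 -> int, x = \sum_i (m i)%:~R *: v (widen_ord kd i))).
  move=> [m mE].
  pose m' (i : 'I_d.+1) : int :=
    if insub (i : nat) is Some j then m (j : 'I_k.+1) else 0.
  have m'0 (i : 'I_d.+1) : (d.-1 <= i)%N -> m' i = 0.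
    by rewrite -kE leqNgt => ik; rewrite /m' insubN.
  have m'w (i : 'I_k.+1) : m' (widen_ord kd i) = m i by rewrite /m' /= valK.
  exists m' => //; rewrite (narrow (fun i => (m' i)%:~R)) => [|i /m'0 -> //].
  by rewrite mE; apply: eq_bigr => i _; rewrite m'w.
move=> nm.
have := @product_sum_shifted R d S v q beta Sfr vint beta_gt0 int_uniq k kd 2
  (fun e => if e == ord0 then 0 else x).
have wE (i : 'I_k.+1) : beta (widen_ord kd i) = sylv_inv R i.
  by rewrite bE /ext_weight /= -kE ltn_ord.
rewrite (eq_bigr (fun i : 'I_k.+1 => sylv_inv R i)) => [|i _]; last exact: wE.
rewrite [X in _ -> _ -> _ -> _ -> _ <= 1 - X](eq_bigr (fun i : 'I_k.+1 => sylv_inv R i)); last first.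
  by move=> i _; apply: wE.
rewrite -(big_mkord xpredT (sylv_inv R)) -(big_mkord xpredT (fun i => sylv_inv R i)).
rewrite prod_sylv_inv // sum_sylv_inv mul1r => H.
suff : 2 * (u k.+1)%:R^-1 <= 1 - (1 - (u k.+1)%:R^-1) :> R.
  have : 0 < (u k.+1)%:R^-1 :> R by rewrite invr_gt0 sylv_prodR_gt0.
  by move: (_^-1) => y; lra.
apply: H.
- by rewrite /k; lia.
- by move=> e; case: ifP => _ //; apply: integral_pt0.
- move=> e; case: ifP => _; last by exists (fun i => mu (widen_ord kd i)); rewrite xE narrow.
  by exists (fun=> 0); rewrite big1 // => i _; rewrite scale0r.
- move=> e e' ee' m mE; apply: nm; move: mE; case: eqP => [e0|e0]; case: eqP => [e0'|e0'].
  + by case: ee'; rewrite e0 e0'.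
  + rewrite sub0r => mE; exists (fun i => - m i); rewrite -[x]opprK mE -sumrN.
    by apply: eq_bigr => i _; rewrite mulrNz scaleNr.
  + by rewrite subr0 => ->; exists m.
  + have e1 (g : 'I_2) : g <> ord0 -> g = ord_max.
      by case: g => [[|[|n]] lt] // ne; [case: ne|]; apply/val_inj.
    by case: ee'; rewrite (e1 e) // (e1 e').
Qed.

(** Used for [l = 1]: as [dot b (v i)] is 1 or -1, subtracting an integral multiple of [v i] moves
    any lattice point into the kernel of [b]. The first [d - 1] vertices span this kernel, so
    [ext_span_int] applies. *)
Lemma unimodular_of_edge (i j : 'I_d.+1) (b : 'rV[R]_d) :
  i = d.-1 :> nat -> j = ord_max -> (forall k : 'I_d.+1, beta k = ew k) ->
  integral b -> (b <= polar_vertex q beta i - polar_vertex q beta j)%MS ->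
  `|dot b (v i)| = 1 -> unimodular q beta.
Proof.
move=> iE jE bE bint /sub_rVP[c cE] b1.
have ij : i != j by rewrite -val_eqE jE /= iE; lia.
have c0 : c != 0.
  apply: contra_eq_neq b1 => c0; rewrite cE c0 scale0r dotC dot0r normr0.
  by rewrite eq_sym oner_neq0.
have bv2 : dot b (v i) * dot b (v i) = 1.
  by rewrite -expr2 -real_normK ?num_real // b1 expr1n.
suff gen x : integral x -> exists2 m : 'I_d.+1 -> int, m ord_max = 0 &
    x = \sum_k (m k)%:~R *: v k.
  move=> k km; apply/integralP => r.
  have [m m0 E] := gen _ (@integral_delta R d r).
  rewrite -dot_delta E dot_sumr; apply: intR_sum => s _; rewrite dotZr.
  case: (eqVneq s ord_max) => [->|sm]; first by rewrite m0 mul0r; exact: (intR_nat _ 0).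
  by rewrite (dual_basis_dot Sfr) //; apply: intRM (intR_int _ _) (intR_nat _ _).
move=> xint.
pose y := x - (dot b (v i) * dot b x) *: v i.
have nint : intR (dot b (v i) * dot b x) by apply: intRM; apply: intR_dot.
have yint : integral y by apply: integral_ptD => //; apply/integral_ptN/integral_ptZ.
have by0 : dot b y = 0.
  by rewrite dotBr dotZr mulrAC bv2 mul1r subrr.
(* Orthogonality to [p i - p j] makes the coordinates of [y] at [i] and [j] the same multiple [rho]
   of the weights; subtracting [rho] times the relation [frame_origin] eliminates both vertices. *)
pose rho := dot (q j) y / beta j.
have rhoE : dot (q i) y = rho * beta i.
  move: by0; rewrite cE dotZl => /eqP; rewrite mulf_eq0 (negPf c0) /= => /eqP.
  rewrite /polar_vertex dotBl !dotZl /rho; have := beta_gt0 i; have := beta_gt0 j => bj bi H.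
  have -> : dot (q i) y = beta i * ((beta i)^-1 * dot (q i) y).
    by rewrite mulrA mulfV ?mul1r ?gt_eqF.
  rewrite mulrC; congr (_ * _); rewrite [RHS]mulrC; lra.
have rhoj : dot (q j) y = rho * beta j by rewrite divfK // gt_eqF.
have [|m m0 yE] := @ext_span_int y bE yint.
  exists (fun k => dot (q k) y - rho * beta k).
    move=> k kd; have [->|->] : k = i \/ k = j.
      have := leq_ord k; rewrite jE => kd'.
      case: (eqVneq (k : nat) d) => [E|E]; [right|left]; apply/val_inj => //=.
      by rewrite iE; lia.
    + by rewrite rhoE subrr.
    + by rewrite rhoj subrr.
  under eq_bigr do rewrite scalerBl -scalerA.
  by rewrite sumrB (frame_decomp Sfr) -scaler_sumr (frame_origin Sfr) scaler0 subr0.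
have [n nE] := nint.
exists (fun k => m k + (if k == i then n else 0)).
  by rewrite -jE [j == i]eq_sym (negPf ij) addr0 m0 // jE /=; lia.
under eq_bigr do rewrite intrD scalerDl.
rewrite big_split /= -yE (bigD1 i) //= eqxx big1 => [|k /negPf ->]; last by rewrite scale0r.
by rewrite addr0 /y nE subrK.
Qed.

End CanonicalSimplex.

(** * Equality cases and the theorem *)

Lemma unimod_equiv_of_max (R : rcfType) (d : nat) (S : 'rV[R]_d -> Prop) l :
  (4 <= d)%N -> in_Sd1 S -> interior S 0 -> (l = 1 \/ l = d)%N ->
  max_volZ (polar S) l (vol_bound R d l) ->
  unimod_equiv S (polar (translate (@S1 R d) (@e_all R d))).
Proof.
move=> d4 S1d S0 l1d [F [Fface [Fdim [Fvol _]]]].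
have d0 : (0 < d)%N by lia.
have [v [q [beta [vint Sfr bs b0 iu]]]] := canonical_frame d0 S1d S0.
have ld : (1 <= l <= d)%N by lia.
have [_ /(_ erefl)[bE [tau [B [t [tinj Bint Bedge tlt [B1 BP]]]]]]] :=
  face_bound vint Sfr b0 bs iu d4 ld Fface Fdim Fvol.
have frE : frame S v q (fun i => ext_weight R d i).
  by split=> [i j|x]; rewrite -?bE ?Sfr.1 // Sfr.2; split=> H i; have := H i; rewrite bE.
have uniE : unimodular q beta -> unimodular q (fun i : 'I_d.+1 => ext_weight R d i).
  by move=> H i /H; rewrite /dual_basis !bE.
apply: (unimod_equiv_ext d0 frE) => [i _|]; first exact: vint.
apply: uniE; case: l1d => lE; subst l.
  (* The remaining weight must be [1/(2 * u d.-1)], whereas an index [i < d.-1] would give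
     [1/(u i + 1)], which is larger as [u i + 1 <= u i.+1 <= u d.-1]. *)
  have tE : tau (lift t ord0) = d.-1 :> nat.
    have := tlt ord0 => lt; have := leq_ord (tau t) => le.
    apply: contraTeq isT => ne.
    have id : (tau (lift t ord0) < d.-1)%N by lia.
    move: BP; rewrite big_ord_recl big_ord0 mulr1 bE /ext_weight id subn1 /sylv_inv.
    have : 0 < (sylv_prod d.-1)%:R :> R by apply: sylv_prodR_gt0.
    set i := tau _ in id *; move=> u0.
    have -> : (sylv_prod d.-1)%:R / (2 * sylv_prod d.-1 ^ 2)%:R =
        (2 * sylv_prod d.-1)%:R^-1 :> R.
      by rewrite !natrM; field; rewrite gt_eqF.
    move=> /invr_inj/eqP; rewrite eqr_nat => /eqP E.
    have : (sylv_prod i.+1 <= sylv_prod d.-1)%N.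
      have mono n m : (sylv_prod n <= sylv_prod (n + m))%N.
        elim: m => [|m IH]; first by rewrite addn0.
        by rewrite addnS sylv_prodS; have := sylv_prod_gt0 (n + m)%N; nia.
      by have -> : d.-1 = (i.+1 + (d.-1 - i.+1))%N by lia.
    by rewrite sylv_prodS; have := sylv_prod_gt0 i; nia.
  have tm : tau t = ord_max.
    by apply/val_inj => /=; have := tlt ord0; have := leq_ord (tau t); lia.
  apply: (unimodular_of_edge vint Sfr b0 iu d4 tE tm bE (Bint ord0)).
    rewrite row_id; apply: submx_trans Bedge _.
    apply: (submx_trans (B := edges (fun s => polar_vertex q beta (tau s)) t)).
      by rewrite (edges_base_change _ ord0 t) submxMl.
    by apply/row_subP => i; rewrite rowK ord1.
  move: B1; rewrite det_mx11 mulmx_tr_dot rowK; exact.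
exact: (unimodular_of_det vint Sfr b0 tinj tlt Bint B1).
Qed.

Theorem mainTheorem6 (R : rcfType) (d : nat) (S : 'rV[R]_d -> Prop) (l : nat) :
  (4 <= d)%N -> in_Sd1 S -> interior S 0 -> (1 <= l <= d)%N ->
  let bound : R :=
    (2 * (sylv d - 1) ^ 2)%:R / ((l`! * (sylv (d - l + 1) - 1))%:R) in
  let Sstar := polar S in
  let Sext := polar (translate (@S1 R d) (@e_all R d)) in
  (forall F v, is_face Sstar F -> has_dim F l -> volZ l F v -> v <= bound) /\
  (unimod_equiv S Sext -> max_volZ Sstar l bound) /\
  ((l = 1 \/ l = d)%N -> (max_volZ Sstar l bound <-> unimod_equiv S Sext)).
Proof.
move=> d4 S1d S0 ld bound Sstar Sext.
have d0 : (0 < d)%N by lia.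
have boundE : bound = vol_bound R d l by rewrite /bound /vol_bound /sylv !addnK addn1.
have [v [q [beta [vint Sfr bs b0 iu]]]] := canonical_frame d0 S1d S0.
have le F val : is_face Sstar F -> has_dim F l -> volZ l F val -> val <= bound.
  rewrite boundE => Fface Fdim Fvol.
  by have [] := face_bound vint Sfr b0 bs iu d4 ld Fface Fdim Fvol.
(* The frame transported from the extremal simplex is a second frame of the same [S]. It supplies a
   face attaining the bound; maximality is [le], proved with the first frame. *)
have eqv : unimod_equiv S Sext -> max_volZ Sstar l bound.
  move=> /(frame_of_unimod_equiv d0 Sfr iu)[v' [q' [Sfr' vint' uni]]].
  have ew0 (i : 'I_d.+1) : 0 < ext_weight R d i by apply: ext_weight_gt0.
  have [F [Fface Fdim Fvol]] := extremal_face_volume Sfr' ew0 ld vint' uni.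
  exists F; split=> //; split=> //; split=> //; move: Fvol.
  have ad : (d - l < d)%N by lia.
  rewrite (eq_big_nat _ _ (F2 := fun i => ext_weight R d i)) => [|i id]; last first.
    by rewrite inordK //; lia.
  rewrite ext_weight_prod // boundE /vol_bound [(l`! * _)%:R]natrM.
  by rewrite invf_div invfM mulrCA mulrC.
split=> //; split=> // l1d; split=> //.
by rewrite boundE; apply: unimod_equiv_of_max.
Qed.
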